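(* Let $\lambda_1,\lambda_2,\mu_1,\mu_2>0$, $\eta_1>0$, $p\in[0,1]$. If $\eta_2=0$, then for $t>0$ and $j\in\mathbb{N}$ the first-passage-time probability density $b_j(t)=\frac{d}{dt}\mathbb{P}(T_j<t)$ is expressed as $$b_j(t)=p\,e^{-\eta_1t}\,\widehat g^{(1)}_{j,0}(t)+(1-p)\,\widehat g^{(2)}_{j,0}(t)+\eta_1p\sum_{k=1}^{\infty}\int_0^te^{-\eta_1\tau}\,\widehat\alpha^{(1)}_{j,k}(\tau)\,\widehat g^{(2)}_{k,0}(t-\tau)\,d\tau,$$ where, for $i=1,2$, $j,k\in\mathbb{N}$ and $t>0$, $$\widehat g^{(i)}_{j,0}(t)=\frac{j}{t}\,e^{-(\lambda_i+\mu_i)t}\Big(\frac{\mu_i}{\lambda_i}\Big)^{j/2}I_j(2t\sqrt{\lambda_i\mu_i}),$$ $$\widehat\alpha^{(i)}_{j,k}(t)=e^{-(\lambda_i+\mu_i)t}\Big(\frac{\lambda_i}{\mu_i}\Big)^{(k-j)/2}\left[I_{k-j}(2t\sqrt{\lambda_i\mu_i})-I_{k+j}(2t\sqrt{\lambda_i\mu_i})\right].$$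
   Context: $\mathbb N=\{1,2,\dots\}$, $\mathbb N_0=\mathbb N\cup\{0\}$, and $I_\nu$ is the modified Bessel function of the first kind. $\{{\bf N}(t)=[N(t),\mathscr{E}(t)],\,t\ge 0\}$ is the continuous-time Markov chain on $\mathbb{N}_0\times\{1,2\}$ with transition rates (case $\eta_2=0$): for $i=1,2$, $(n,i)\to(n+1,i)$ at rate $\lambda_i$ ($n\ge0$), $(n,i)\to(n-1,i)$ at rate $\mu_i$ ($n\ge1$), and $(n,1)\to(n,2)$ at rate $\eta_1$ ($n\ge0$). The initial state is ${\bf N}(0)=(j,1)$ with probability $p$ and $(j,2)$ with probability $1-p$, with $j\in\mathbb{N}$. The first-passage time through zero is $T_j=\inf\{t>0:{\bf N}(t)=(0,1)\text{ or }{\bf N}(t)=(0,2)\}$. For the $M/M/1$ queue with arrival rate $\lambda_i$ and service rate $\mu_i$, $\widehat g^{(i)}_{j,0}$ is the first-passage-time density from $j$ to $0$, and $\widehat\alpha^{(i)}_{j,k}(t)$ is the transition probability from $j$ to $k$ avoiding $0$. *)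

(* Defs.v *)
From HB Require Import structures.
From mathcomp Require Import all_boot all_order all_algebra.
From mathcomp Require Import all_classical all_reals all_analysis.
Set Implicit Arguments.
Unset Strict Implicit.
Unset Printing Implicit Defensive.
Import Order.TTheory GRing.Theory Num.Theory.
Import numFieldNormedType.Exports.
Local Open Scope classical_set_scope.
Local Open Scope ring_scope.

(* [1 / Gamma(n + 1)] at an integer [n]: it vanishes at the poles of Gamma. *)
Definition invGammaS {R : realType} (n : int) : R :=
  if n is Posz k then (k`!%:R)^-1 else 0.

(* Modified Bessel function of the first kind, of integer order [nu]:
   I_nu(x) = sum_(m >= 0) (x / 2)^(2 m + nu) / (m! Gamma(m + nu + 1)).
   When [2 m + nu < 0] also [m + nu < 0], so negative powers of [x / 2] always
   carry the coefficient 0. *)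
Definition besselI {R : realType} (nu : int) (x : R) : R :=
  limn (series (fun m : nat =>
    (x / 2) ^ ((2 * m)%:Z + nu) * (m`!%:R)^-1 * invGammaS (m%:Z + nu))).

Section mm1.
Context {R : realType}.
Implicit Types (lam mu t : R) (j k : nat).

Definition ghat lam mu j t : R :=
  j%:R / t * expR (- (lam + mu) * t) * (mu / lam) `^ (j%:R / 2) *
  besselI j%:Z (2 * t * Num.sqrt (lam * mu)).

Definition alphahat lam mu j k t : R :=
  expR (- (lam + mu) * t) * (lam / mu) `^ ((k%:R - j%:R) / 2) *
  (besselI (k%:Z - j%:Z) (2 * t * Num.sqrt (lam * mu)) -
   besselI (k%:Z + j%:Z) (2 * t * Num.sqrt (lam * mu))).

End mm1.

(* [tp t x y] is a stochastic transition function on the countable state space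
   [S] whose transition rates are [rate x y] for [x != y]; the values
   [rate x x] are irrelevant.  [tf_diag] says that the rate of leaving [x] is
   the total rate of the transitions out of [x]. *)
Record transition_function {R : realType} {S : countType}
    (rate : S -> S -> R) (tp : R -> S -> S -> R) : Prop := TransitionFunction {
  tf_ge0 : forall (t : R) (x y : S), 0 <= t -> 0 <= tp t x y ;
  tf_sum1 : forall (t : R) (x : S), 0 <= t ->
    (\esum_(y in [set: S]) (tp t x y)%:E = 1)%E ;
  tf_init : forall x y : S, tp 0 x y = (x == y)%:R ;
  tf_chapman_kolmogorov : forall (s t : R) (x z : S), 0 <= s -> 0 <= t ->
    ((tp (s + t) x z)%:E = \esum_(y in [set: S]) (tp s x y * tp t y z)%:E)%E ;
  tf_rate : forall x y : S, x != y -> tp h x y / h @[h --> 0^'+] --> rate x y ;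
  tf_diag : forall x : S, ((1 - tp h x x) / h)%:E @[h --> 0^'+] -->
    (\esum_(y in [set~ x]) (rate x y)%:E)%E }.

(* Continuous-time Markov chain [X] on [S] with the given transition rates,
   with right-continuous paths for the discrete topology of [S]; only times
   [t >= 0] matter.  [ctmc_markov] is the time-homogeneous Markov property
     P(X_(u (n+1)) = x (n+1) | X_(u 0) = x 0, ..., X_(u n) = x n)
       = tp (u (n+1) - u n) (x n) (x (n+1))
   multiplied out by the probability of the conditioning event. *)
Record ctmc_with {R : realType} {S : countType} (tp : R -> S -> S -> R)
    {d : measure_display} {Omega : measurableType d} (P : probability Omega R)
    (X : R -> Omega -> S) : Prop := CtmcWith {
  ctmc_measurable : forall (t : R) (x : S), 0 <= t ->
    measurable [set w | X t w = x] ;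
  ctmc_right_continuous : forall (w : Omega) (t : R), 0 <= t ->
    \forall s \near t^'+, X s w = X t w ;
  ctmc_markov : forall (n : nat) (u : nat -> R) (x : nat -> S), 0 <= u 0%N ->
    (forall k, (k <= n)%N -> u k < u k.+1) ->
    (P [set w | forall k, (k <= n.+1)%N -> X (u k) w = x k] =
     P [set w | forall k, (k <= n)%N -> X (u k) w = x k] *
     (tp (u n.+1 - u n) (x n) (x n.+1))%:E)%E }.

Definition ctmc {R : realType} {S : countType} (rate : S -> S -> R)
    {d : measure_display} {Omega : measurableType d} (P : probability Omega R)
    (X : R -> Omega -> S) : Prop :=
  exists2 tp : R -> S -> S -> R,
    transition_function rate tp & ctmc_with tp P X.

(* The environments 1 and 2 are the elements 0 and 1 of ['I_2]. *)
Definition env : countType := 'I_2.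
Definition env1 : env := ord0.
Definition env2 : env := ord_max.

(* (n, i) -> (n + 1, i) at rate [lam i], (n + 1, i) -> (n, i) at rate [mu i],
   and (n, i) -> (n, i') with [i' != i] at rate [eta i]. *)
Definition queue_rate {R : realType} (lam mu eta : env -> R)
    (x y : nat * env) : R :=
  if x.2 == y.2 then
    if y.1 == x.1.+1 then lam x.2 else if x.1 == y.1.+1 then mu x.2 else 0
  else if x.1 == y.1 then eta x.2 else 0.

(* The infimum is +oo when the queue is never empty at a positive time. *)
Definition first_passage_time {R : realType} {Omega : Type}
    (X : R -> Omega -> nat * env) (w : Omega) : \bar R :=
  ereal_inf [set t%:E | t in
    [set t : R | 0 < t /\ (X t w = (0%N, env1) \/ X t w = (0%N, env2))]].

Definition first_passage_cdf {R : realType} {d : measure_display}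
    {Omega : measurableType d} (P : probability Omega R)
    (X : R -> Omega -> nat * env) (t : R) : R :=
  fine (P [set w | (first_passage_time X w < t%:E)%E]).

Definition first_passage_density {R : realType} {d : measure_display}
    {Omega : measurableType d} (P : probability Omega R)
    (X : R -> Omega -> nat * env) : R -> R :=
  derive1 (first_passage_cdf P X).

(* Main.v *)
Require Import Defs.
From HB Require Import structures.
From mathcomp Require Import all_boot all_order all_algebra.
From mathcomp Require Import ring lra zify.
From mathcomp Require Import all_classical all_reals all_analysis.
Set Implicit Arguments.
Unset Strict Implicit.
Unset Printing Implicit Defensive.
Import Order.TTheory GRing.Theory Num.Theory.
Import numFieldNormedType.Exports.
Local Open Scope classical_set_scope.
Local Open Scope ring_scope.

(** The chain has bounded rates, so as long as it stays among the busy states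
    (those with a nonempty queue) it is governed by the bounded operator
    [killed g = 1_busy * (generator g)].  Everything rests on its exponential.

    - The survival probability.  Observed at the multiples of a step [h], the
      probability of having been busy at the first [n + 1] observations
      satisfies an exact one-step recursion, by the Markov property
      ([on_path_staysE]).  A transition function with bounded rates differs
      from its first-order expansion by [O(h ^ 2)], uniformly in the state
      ([expect_step]): the lower bounds on staying put and on a single jump
      already account for a mass of [1 - O(h ^ 2)].  So the recursion is an
      Euler scheme for [f' = killed f] ([survival_approx]).  Its solution is
      the exponential series [killed_semigroup], and right-continuity of the
      paths lets dyadic observation times capture the whole path
      ([stays_before_prob]).

    - The density.  Hence the distribution function of the first passage is a
      mixture of smooth functions whose derivatives, [exit_density], solve the
      backward equations of the killed chain and start from the rates of
      jumping to the empty queue.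

    - The kernel.  The Bessel expression for the transition probabilities of an
      M/M/1 queue avoiding zero solves the forward equations.  Indeed
      [(lam / mu) ^ (v / 2) * I_v (2 t sqrt (lam mu))] is the exponential
      generating function in [t] of the weighted number of nearest-neighbour
      walks from 0 to [v] ([walk_egf_bessel]), for which the equation is the
      last-step decomposition; the difference of two such functions is the
      reflection principle.

    - The formula.  Pairing the forward kernel at time [tau] with the backward
      solution at time [t - tau] gives a quantity whose derivative in [tau] is
      only the loss to the other environment, up to a boundary term at the
      truncation level, which decays geometrically ([duhamel_taboo]).
      Integrating over [0, t] yields the formula.  In the environment that is
      never left there is no loss, so its density is [ghat]; substituting this
      into the formula for the other environment gives the result. *)

(** * Exponential generating functions *)

Section Calculus.
Context {R : realType}.

Lemma is_derive_continuous (f : R -> R) (x df : R) :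
  is_derive x 1 f df -> {for x, continuous f}.
Proof. by case=> /derivable1_diffP/differentiable_continuous. Qed.

Lemma mean_value_le (f f' : R -> R) (a b K : R) : a <= b ->
    (forall x, a <= x <= b -> is_derive x 1 f (f' x)) ->
    (forall x, a <= x <= b -> `|f' x| <= K) ->
  `|f b - f a| <= K * (b - a).
Proof.
move=> ab fD f'K.
have [||c] := @MVT_segment _ f f' _ _ ab.
- by move=> x; rewrite in_itv/= => /andP[ax xb]; apply: fD; rewrite !ltW.
- apply: derivable_within_continuous => x; rewrite in_itv/= => axb.
  by have [] := fD x axb.
- rewrite in_itv/= => acb ->; rewrite normrM [`|b - a|]ger0_norm ?subr_ge0//.
  by apply: ler_wpM2r; [rewrite subr_ge0|exact: f'K].
Qed.

End Calculus.

Section Egf.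
Context {R : realType}.
Implicit Types (c : nat -> R) (C M t : R).

(** Geometric growth of the coefficients makes the exponential generating
    function entire, with termwise derivative the shift of the coefficients. *)
Definition geo_bounded C M c := forall n, `|c n| <= C * M ^+ n.

Definition egf c t : R := limn (pseries (fun n => c n / n`!%:R) t).

Lemma egf_term_le C M c t n : geo_bounded C M c ->
  `|c n / n`!%:R * t ^+ n| <= C * exp_coeff (M * `|t|) n.
Proof.
move=> cM; rewrite !normrM normrX normfV [`|n`!%:R|]ger0_norm// /exp_coeff/=.
rewrite exprMn.
have -> : C * (M ^+ n * `|t| ^+ n / n`!%:R) =
          C * M ^+ n * (`|t| ^+ n / n`!%:R) by ring.
by rewrite -[leLHS]mulrA [n`!%:R^-1 * _]mulrC ler_wpM2r// divr_ge0.
Qed.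

Lemma egf_normed_cvg C M c t : geo_bounded C M c ->
  cvgn [normed pseries (fun n => c n / n`!%:R) t].
Proof.
move=> cM.
have cv : cvgn (series (fun n => C * exp_coeff (M * `|t|) n)).
  exact/is_cvg_seriesZ/is_cvg_series_exp_coeff.
apply: series_le_cvg cv => [|n|n] //=; last exact: egf_term_le.
exact: le_trans (egf_term_le t n cM).
Qed.

Lemma egf_cvg C M c t : geo_bounded C M c ->
  cvgn (pseries (fun n => c n / n`!%:R) t).
Proof. by move=> /(@egf_normed_cvg _ _ _ t) /normed_cvg. Qed.

Lemma egf_le C M c t : geo_bounded C M c ->
  `|egf c t| <= C * expR (M * `|t|).
Proof.
move=> cM; have ncv := @egf_normed_cvg _ _ _ t cM.
apply: le_trans (lim_series_norm ncv) _.
have cve := is_cvg_series_exp_coeff (M * `|t|).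
rewrite /expR -[C * _](lim_seriesZ _ cve).
apply: lim_series_le => // [|n]; first exact: is_cvg_seriesZ.
exact: egf_term_le.
Qed.

Lemma geo_bounded_shift C M c : geo_bounded C M c ->
  geo_bounded (C * M) M (fun n => c n.+1).
Proof. by move=> cM n; rewrite -mulrA -exprS. Qed.

Lemma egf_is_derive C M c t : geo_bounded C M c ->
  is_derive t 1 (egf c) (egf (fun n => c n.+1) t).
Proof.
move=> cM.
have E (d : nat -> R) : pseries_diffs (fun n => d n / n`!%:R) =
    (fun n => d n.+1 / n`!%:R).
  apply/funext => n; rewrite /pseries_diffs factS natrM.
  by rewrite invfM mulrCA mulVKf ?pnatr_eq0.
rewrite /egf -E; apply: (@pseries_snd_diffs _ _ (`|t| + 1)).
- exact: egf_cvg cM.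
- by rewrite E; apply: egf_cvg (geo_bounded_shift cM).
- rewrite E (E (fun n => c n.+1)).
  by apply: egf_cvg (geo_bounded_shift (geo_bounded_shift cM)).
- by rewrite (ger0_norm (addr_ge0 _ _))// ltrDl.
Qed.

(** The constant term is [c 0], since [0 ^+ 0 = 1]. *)
Lemma egf0 c : egf c 0 = c 0%N.
Proof.
apply: cvg_lim => //; apply: (@cvg_near_cst _ _ _ _ _ _ _).
exists 1%N => // n /= n0; rewrite /pseries /series /=.
rewrite -(subnKC n0) add1n big_nat_recl//= big1 ?addr0.
  by rewrite expr0 mulr1 fact0 divr1.
by move=> i _; rewrite expr0n mulr0.
Qed.

Lemma egf_lin C1 M1 C2 M2 (a b : R) c d t :
    geo_bounded C1 M1 c -> geo_bounded C2 M2 d ->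
  egf (fun n => a * c n + b * d n) t = a * egf c t + b * egf d t.
Proof.
move=> cM dM; have cc := @egf_cvg _ _ _ t cM; have cd := @egf_cvg _ _ _ t dM.
rewrite /egf -[a * _](lim_seriesZ _ cc) -[b * _](lim_seriesZ _ cd).
rewrite -lim_seriesD; [|exact: is_cvg_seriesZ..].
congr (limn (series _)); apply/funext => n; rewrite !fctE /GRing.scale/=.
ring.
Qed.

Lemma egf_scale C M (a : R) (c : nat -> R) t : geo_bounded C M c ->
  egf (fun n => a * c n) t = a * egf c t.
Proof.
move=> cM; have -> : (fun n => a * c n) = fun n => a * c n + 0 * c n.
  by apply/funext => n; rewrite mul0r addr0.
by rewrite (egf_lin _ _ _ cM cM) mul0r addr0.
Qed.

Lemma egf_sum (I : Type) (r : seq I) (a : I -> R) (c : I -> nat -> R) C M t :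
    (forall i, geo_bounded C M (c i)) ->
  (exists C', geo_bounded C' M (fun n => \sum_(i <- r) a i * c i n)) /\
  egf (fun n => \sum_(i <- r) a i * c i n) t = \sum_(i <- r) a i * egf (c i) t.
Proof.
move=> cM; elim: r => [|i r [[C' IHb] IH]].
  rewrite big_nil; split.
    by exists 0 => n; rewrite big_nil normr0 mul0r.
  have -> : (fun n => \sum_(i <- [::]) a i * c i n) = fun=> 0.
    by apply/funext => n; rewrite big_nil.
  apply/eqP; rewrite -normr_le0; apply: le_trans (egf_le (C := 0) (M := 0) _ _) _.
    by move=> n; rewrite normr0 mul0r.
  by rewrite mul0r.
have E1 : (fun n => \sum_(i <- i :: r) a i * c i n) =
    fun n => a i * c i n + 1 * (\sum_(i <- r) a i * c i n).
  by apply/funext => n; rewrite big_cons mul1r.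
rewrite E1 (egf_lin _ _ _ (cM i) IHb) big_cons mul1r IH; split => //.
exists (`|a i| * C + C') => n; rewrite mul1r.
apply: le_trans (ler_normD _ _) _; rewrite mulrDl lerD// normrM -mulrA.
by rewrite ler_wpM2l// cM.
Qed.

(** Second-order remainder with a constant uniform in the sequence, which is
    what allows it to be used uniformly over the states of the chain.  It
    comes from two applications of the mean value inequality. *)
Lemma egf_taylor C M c t h : 0 <= M -> geo_bounded C M c -> 0 <= t -> 0 <= h ->
  `|egf c (t + h) - egf c t - h * egf (fun n => c n.+1) t| <=
  C * M ^+ 2 * expR (M * (t + h)) * h ^+ 2.
Proof.
move=> M0 cM t0 h0.
have C0 : 0 <= C by have := cM 0%N; rewrite mulr1; apply: le_trans.
have cM1 := geo_bounded_shift cM; have cM2 := geo_bounded_shift cM1.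
pose K := C * M ^+ 2 * expR (M * (t + h)).
have K0 : 0 <= K by rewrite !mulr_ge0// ?expR_ge0// exprn_ge0.
have D1 s : t <= s <= t + h ->
    `|egf (fun n => c n.+1) s - egf (fun n => c n.+1) t| <= K * h.
  move=> /andP[ts sth]; apply: le_trans (_ : K * (s - t) <= _); last first.
    by rewrite ler_wpM2l// lerBlDl.
  apply: (@mean_value_le _ _ (egf (fun n => c n.+2))) => // x /andP[tx xs].
    exact: egf_is_derive cM1.
  apply: le_trans (egf_le x cM2) _; rewrite /K expr2 !mulrA ler_wpM2l//.
    by rewrite !mulr_ge0.
  rewrite ler_expR ler_wpM2l// ger0_norm ?(le_trans xs)//.
  exact: le_trans tx.
have := @mean_value_le _ (fun s => egf c s - s * egf (fun n => c n.+1) t)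
  (fun s => egf (fun n => c n.+1) s - egf (fun n => c n.+1) t) t (t + h) (K * h).
rewrite lerDl h0 => /(_ isT) H.
have -> : egf c (t + h) - egf c t - h * egf (fun n => c n.+1) t =
  egf c (t + h) - (t + h) * egf (fun n => c n.+1) t -
  (egf c t - t * egf (fun n => c n.+1) t) by ring.
rewrite -/K (_ : K * h ^+ 2 = K * h * (t + h - t)); last by ring.
apply: H => // x _.
have := egf_is_derive x cM => ?.
apply: is_derive_eq; rewrite scaler0 add0r /GRing.scale/=; ring.
Qed.

End Egf.

(** * Short-time bounds for transition functions *)

Section TransitionFunction.
Context {R : realType} {S : countType}.
Variables (rate : S -> S -> R) (tp : R -> S -> S -> R).
Hypothesis tpP : transition_function rate tp.
Implicit Types (x y z : S) (s t h q : R).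

Lemma esum_seq_ge (f : S -> R) (r : seq S) : uniq r -> (forall x, 0 <= f x) ->
  ((\sum_(y <- r) f y)%:E <= \esum_(y in [set: S]) (f y)%:E)%E.
Proof.
move=> ur f0; apply: esum_ge; exists [set` r].
  by split => //; exact: finite_seq.
by rewrite -fsbig_seq// sumEFin.
Qed.

Let tp_ge0 := tf_ge0 tpP.

Lemma tp_le1 t x y : 0 <= t -> tp t x y <= 1.
Proof.
move=> t0; rewrite -lee_fin -(tf_sum1 tpP x t0).
have := @esum_seq_ge (tp t x) [:: y]; rewrite big_seq1; apply => // z.
exact: tp_ge0.
Qed.

(** Keeping finitely many intermediate states in the Chapman-Kolmogorov
    equation turns it into an inequality between finite sums. *)
Lemma tp_ck_ge s t x z (r : seq S) : uniq r -> 0 <= s -> 0 <= t ->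
  \sum_(y <- r) tp s x y * tp t y z <= tp (s + t) x z.
Proof.
move=> ur s0 t0; rewrite -lee_fin (tf_chapman_kolmogorov tpP)//.
by apply: esum_seq_ge => // y; rewrite mulr_ge0// tp_ge0.
Qed.

Lemma cvg_nbhs_right_div (f : R -> R) (h l : R) : 0 < h ->
  f e @[e --> 0^'+] --> l -> f (h / n.+1%:R) @[n --> \oo] --> l.
Proof.
move=> h0 /cvg_at_rightP; apply; split; first by move=> n; rewrite divr_gt0.
rewrite -(mulr0 h); apply: cvgM; first exact: cvg_cst.
exact: cvg_harmonic.
Qed.

(** Iterating Chapman-Kolmogorov through [x] itself gives, as in Bernoulli's
    inequality, [1 - tp (n e) x x <= n * (1 - tp e x x)].  With [e = h / n] the
    right-hand side tends to [q h], which removes the limit from the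
    definition of the rate and leaves a bound valid at every time. *)
Lemma tp_stay_ge x q : 0 <= q ->
  (\esum_(y in [set~ x]) (rate x y)%:E)%E = q%:E ->
  forall h, 0 <= h -> 1 - q * h <= tp h x x.
Proof.
move=> q0 Eq h; rewrite le_eqVlt => /predU1P[<-|h0].
  by rewrite (tf_init tpP) eqxx mulr0 subr0.
have mult e n : 0 <= e -> 1 - n%:R * (1 - tp e x x) <= tp (n%:R * e) x x.
  move=> e0; elim: n => [|n IH]; first by rewrite !mul0r (tf_init tpP) eqxx subr0.
  have ne0 : 0 <= n%:R * e by rewrite mulr_ge0.
  have := @tp_ck_ge (n%:R * e) e x x [:: x] isT ne0 e0.
  have -> : n%:R * e + e = n.+1%:R * e by rewrite -natr1; ring.
  rewrite big_seq1; apply: le_trans; rewrite -natr1.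
  have := tp_le1 x x ne0; have := tp_le1 x x e0.
  by rewrite -subr_ge0 => A; rewrite -subr_ge0 => B; have := mulr_ge0 A B; nra.
have lim : h * ((1 - tp (h / n.+1%:R) x x) / (h / n.+1%:R)) @[n --> \oo] --> h * q.
  apply: cvgM; first exact: cvg_cst.
  apply: (@cvg_nbhs_right_div (fun e => (1 - tp e x x) / e)) => //.
  by have := @tf_diag _ _ _ _ tpP x; rewrite Eq => /fine_cvgP[].
rewrite lerBlDr -lerBlDl [q * h]mulrC.
suff : \forall n \near \oo, 1 - tp h x x <=
    h * ((1 - tp (h / n.+1%:R) x x) / (h / n.+1%:R)).
  exact: ler_cvg_to (cvg_cst _) lim.
near=> n.
have n0 : 0 < n.+1%:R :> R by rewrite ltr0n.
have hn0 : 0 <= h / n.+1%:R by rewrite ltW// divr_gt0.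
have := mult (h / n.+1%:R) n.+1 hn0.
rewrite mulrCA divff ?mulr1 ?gt_eqF// invf_div => H.
have -> : h * ((1 - tp (h / n.+1%:R) x x) * (n.+1%:R / h)) =
  n.+1%:R * (1 - tp (h / n.+1%:R) x x) by field; rewrite gt_eqF.
by rewrite lerBlDr -lerBlDl.
Unshelve. all: by end_near. Qed.

(** To be at [y] at time [n e] it suffices to stay at [x], jump to [y] during
    one of the [n] slots, and be back at [y] at the end; these scenarios are
    disjoint according to the slot of the jump.  Letting [e = h / n] turns
    [n * tp e x y] into [h * rate x y]. *)
Lemma tp_jump_ge x y q : x != y -> 0 <= q ->
    (forall h, 0 <= h -> 1 - q * h <= tp h x x) ->
    (forall h, 0 <= h -> 1 - q * h <= tp h y y) ->
  forall h, 0 <= h -> q * h <= 1 ->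
  h * rate x y * (1 - q * h) <= tp h x y.
Proof.
move=> xy q0 stx sty h; rewrite le_eqVlt => /predU1P[<-|h0 qh1].
  by rewrite !mul0r; rewrite tp_ge0.
have mult e n : 0 <= e -> q * e <= 1 ->
    n%:R * tp e x y * (1 - q * (n%:R * e)) <= tp (n%:R * e) x y.
  move=> e0 qe1; elim: n => [|n IH].
    by rewrite !mul0r tp_ge0.
  have ne0 : 0 <= n%:R * e by rewrite mulr_ge0.
  (* The two intermediate states: still at [x] after one slot, or already at [y]. *)
  have uxy : uniq [:: x; y] by rewrite /= inE xy.
  have := tp_ck_ge x y uxy e0 ne0.
  have -> : e + n%:R * e = n.+1%:R * e by rewrite -natr1; ring.
  rewrite big_cons big_seq1; apply: le_trans; rewrite -natr1.
  have A := stx _ e0; have B := sty _ ne0; have C := tp_ge0 x y e0.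
  have D := tp_ge0 x y ne0.
  have T1 : 0 <= (tp e x x - (1 - q * e)) * tp (n%:R * e) x y.
    by rewrite mulr_ge0// subr_ge0.
  have T2 : 0 <= tp e x y * (tp (n%:R * e) y y - (1 - q * (n%:R * e))).
    by rewrite mulr_ge0// subr_ge0.
  have T3 : 0 <= (1 - q * e) * (tp (n%:R * e) x y -
      n%:R * tp e x y * (1 - q * (n%:R * e))).
    by rewrite mulr_ge0// subr_ge0.
  have T4 : 0 <= tp e x y * (q * e) * (1 + n%:R * (q * (n%:R * e))).
    by rewrite !mulr_ge0// addr_ge0// !mulr_ge0.
  nra.
have lim : h * (tp (h / n.+1%:R) x y / (h / n.+1%:R)) * (1 - q * h)
    @[n --> \oo] --> h * rate x y * (1 - q * h).
  apply: cvgM; last exact: cvg_cst.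
  apply: cvgM; first exact: cvg_cst.
  apply: (@cvg_nbhs_right_div (fun e => tp e x y / e)) => //.
  exact: tf_rate.
suff : \forall n \near \oo,
    h * (tp (h / n.+1%:R) x y / (h / n.+1%:R)) * (1 - q * h) <= tp h x y.
  exact: ler_cvg_to lim (cvg_cst _).
near=> n.
have n0 : 0 < n.+1%:R :> R by rewrite ltr0n.
have hn0 : 0 <= h / n.+1%:R by rewrite ltW// divr_gt0.
have := mult (h / n.+1%:R) n.+1 hn0.
have -> : n.+1%:R * (h / n.+1%:R) = h by field; rewrite gt_eqF.
have -> : h * (tp (h / n.+1%:R) x y / (h / n.+1%:R)) =
  n.+1%:R * tp (h / n.+1%:R) x y by field; rewrite !gt_eqF.
apply; apply: le_trans qh1; rewrite ler_wpM2l//.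
by rewrite ler_pdivrMr// ler_peMr ?ler1n// ltW.
Unshelve. all: by end_near. Qed.

End TransitionFunction.

(** * One-step expansion and discrete survival for bounded rates *)

Section BoundedRates.
Context {R : realType} {S : countType}.
Variables (rate : S -> S -> R) (tp : R -> S -> S -> R).
Variables (nbr : S -> seq S) (q : R).
Hypothesis tpP : transition_function rate tp.
Hypothesis nbr_uniq : forall x, uniq (x :: nbr x).
Hypothesis rate_ge0 : forall x y, 0 <= rate x y.
Hypothesis rate_out : forall x y, x != y -> y \notin nbr x -> rate x y = 0.
Hypothesis rate_le : forall x, \sum_(y <- nbr x) rate x y <= q.
Implicit Types (x y z : S) (s t h : R) (g : S -> R) (E : pred S).

Definition generator g x := \sum_(y <- nbr x) rate x y * (g y - g x).

Lemma generatorE g x : generator g x =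
  \sum_(y <- nbr x) rate x y * g y - (\sum_(y <- nbr x) rate x y) * g x.
Proof. by rewrite mulr_suml -sumrB; apply: eq_bigr => y _; ring. Qed.

Definition expect h g x := fine (\esum_(y in [set: S]) (tp h x y * g y)%:E).

(** The probability, from [x], that the chain is in [E] at the times
    [0, h, ..., n h]. *)
Fixpoint survival E h n x : R :=
  if n is m.+1 then (E x)%:R * expect h (survival E h m) x else (E x)%:R.

Let tp_ge0 := tf_ge0 tpP.

Lemma rate_sum_ge0 x : 0 <= \sum_(y <- nbr x) rate x y.
Proof. by apply: sumr_ge0. Qed.

Lemma exit_rateE x : (\esum_(y in [set~ x]) (rate x y)%:E)%E =
  (\sum_(y <- nbr x) rate x y)%:E.
Proof.
have /andP[xr ur] := nbr_uniq x.
have rE y : (0 <= (rate x y)%:E)%E by rewrite lee_fin.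
rewrite (esumID [set` nbr x])//.
rewrite (_ : [set~ x] `&` [set` nbr x] = [set` nbr x]); last first.
  by apply/setIidPr => y /= yr yx; move/negP: xr; apply; rewrite -{1}yx.
rewrite [X in (_ + X)%E]esum1 ?adde0; last first.
  move=> y [/= yx yr]; rewrite rate_out//; last exact/negP.
  by rewrite eq_sym; apply/eqP.
by rewrite esum_fset//; [rewrite -fsbig_seq// sumEFin|exact: finite_seq].
Qed.

Lemma stay_ge x h : 0 <= h -> 1 - (\sum_(y <- nbr x) rate x y) * h <= tp h x x.
Proof. by move=> h0; exact: (tp_stay_ge tpP (rate_sum_ge0 x) (exit_rateE x)). Qed.

Lemma stay_ge_unif x h : 0 <= h -> 1 - q * h <= tp h x x.
Proof.
move=> h0; apply: le_trans (stay_ge x h0).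
by rewrite lerD2l lerN2 ler_wpM2r.
Qed.

Lemma bound_ge0 x : 0 <= q.
Proof. exact: le_trans (rate_sum_ge0 x) (rate_le x). Qed.

Lemma expect_fin h g x : 0 <= h -> (forall y, 0 <= g y <= 1) ->
  (\esum_(y in [set: S]) (tp h x y * g y)%:E)%E = (expect h g x)%:E /\
  0 <= expect h g x <= 1.
Proof.
move=> h0 g01.
have A0 : (0 <= \esum_(y in [set: S]) (tp h x y * g y)%:E)%E.
  apply: esum_ge0 => y _; rewrite lee_fin mulr_ge0// ?tp_ge0//.
  by case/andP: (g01 y).
have A1 : (\esum_(y in [set: S]) (tp h x y * g y)%:E <= 1)%E.
  rewrite -(tf_sum1 tpP x h0); apply: le_esum => y _; rewrite lee_fin.
  by rewrite ler_piMr ?tp_ge0//; case/andP: (g01 y).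
have F : (expect h g x)%:E = (\esum_(y in [set: S]) (tp h x y * g y)%:E)%E.
  rewrite /expect fineK// ge0_fin_numE//.
  exact: le_lt_trans A1 (ltry 1).
by rewrite F; split => //; rewrite -!lee_fin F A0.
Qed.

(** Only [x] and its neighbours are kept in the expectation.  For these the
    transition probabilities are bounded below by their first-order values, up
    to [O(h ^ 2)]. *)
Lemma expect_ge h g x : 0 <= h -> q * h <= 1 -> (forall y, 0 <= g y <= 1) ->
  g x + h * generator g x - q ^+ 2 * h ^+ 2 <= expect h g x.
Proof.
move=> h0 qh1 g01.
have g0 y : 0 <= g y by case/andP: (g01 y).
have g1 y : g y <= 1 by case/andP: (g01 y).
have [FE _] := expect_fin x h0 g01.
rewrite -lee_fin -FE; apply: le_trans (esum_seq_ge (nbr_uniq x) _); last first.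
  by move=> y; rewrite mulr_ge0// tp_ge0.
rewrite lee_fin big_cons.
set Q := \sum_(y <- nbr x) rate x y.
apply: (@le_trans _ _ ((1 - Q * h) * g x +
    \sum_(y <- nbr x) h * rate x y * (1 - q * h) * g y)); last first.
  apply: lerD; first by rewrite ler_wpM2r// stay_ge.
  rewrite !big_seq; apply: ler_sum => y yr; rewrite ler_wpM2r//.
  have xy : x != y.
    by case/andP: (nbr_uniq x) => /negP xr _; apply/eqP => xy; rewrite {1}xy in xr.
  apply: (tp_jump_ge tpP xy (bound_ge0 x)) h0 qh1 => e e0;
    exact: stay_ge_unif.
have -> : \sum_(y <- nbr x) h * rate x y * (1 - q * h) * g y =
    h * (1 - q * h) * \sum_(y <- nbr x) rate x y * g y.
  by rewrite mulr_sumr; apply: eq_bigr => y _; ring.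
rewrite generatorE -/Q.
set G := \sum_(y <- nbr x) rate x y * g y.
have GQ : G <= Q.
  by apply: ler_sum => y _; rewrite ler_piMr.
have Qq : Q <= q := rate_le x.
have q0 := bound_ge0 x.
have -> : (1 - Q * h) * g x + h * (1 - q * h) * G =
  g x + h * (G - Q * g x) - q * G * h ^+ 2 by ring.
rewrite lerD2l lerN2 ler_wpM2r ?exprn_ge0// expr2 ler_wpM2l//.
exact: le_trans GQ Qq.
Qed.

Lemma expect_compl h g x : 0 <= h -> (forall y, 0 <= g y <= 1) ->
  expect h (fun y => 1 - g y) x = 1 - expect h g x.
Proof.
move=> h0 g01.
have g01' y : 0 <= 1 - g y <= 1.
  by case/andP: (g01 y) => a b; rewrite subr_ge0 b/= gerBl.
have [F1 _] := expect_fin x h0 g01; have [F2 _] := expect_fin x h0 g01'.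
apply/eqP; rewrite -subr_eq opprK -[X in _ + X]/(expect h g x) addrC.
rewrite -eqe EFinD -F1 -F2 -(tf_sum1 tpP x h0) -esumD.
- apply/eqP; apply: eq_esum => y _; rewrite -EFinD; congr EFin; ring.
- by move=> y _; rewrite lee_fin mulr_ge0 ?tp_ge0//; case/andP: (g01 y).
- by move=> y _; rewrite lee_fin mulr_ge0 ?tp_ge0//; case/andP: (g01' y).
Qed.

(** Total mass one turns the lower bound applied to [1 - g] into the matching
    upper bound.  The remainder does not depend on the state. *)
Lemma expect_step h g x : 0 <= h -> q * h <= 1 -> (forall y, 0 <= g y <= 1) ->
  `|expect h g x - (g x + h * generator g x)| <= q ^+ 2 * h ^+ 2.
Proof.
move=> h0 qh1 g01; have lo := expect_ge x h0 qh1 g01.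
have := @expect_ge h (fun y => 1 - g y) x h0 qh1.
rewrite expect_compl//.
have -> : generator (fun y => 1 - g y) x = - generator g x.
  by rewrite /generator -sumrN; apply: eq_bigr => y _; ring.
move=> hi; rewrite ler_norml; apply/andP; split; first lra.
have : forall y, 0 <= 1 - g y <= 1.
  by move=> y; case/andP: (g01 y) => a b; rewrite subr_ge0 b/= gerBl.
by move=> /hi; lra.
Qed.

Lemma survival01 E h n x : 0 <= h -> 0 <= survival E h n x <= 1.
Proof.
move=> h0; elim: n x => [|n IH] x /=; first by case: (E x); rewrite ?lexx ler01.
have [_] := expect_fin x h0 IH.
by case: (E x); rewrite ?mul1r ?mul0r ?lexx ?ler01.
Qed.

(** The discrete survival probabilities are an Euler scheme for any [f] that
    satisfies [f' = generator f] on [E] and vanishes off [E].  The scheme is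
    stable: for [q h <= 1] one step is a convex combination, so each step only
    adds its local error. *)
Lemma survival_approx E (f : R -> S -> R) (T K h : R) : 0 <= K ->
    (forall x, f 0 x = (E x)%:R) ->
    (forall t x, ~~ E x -> f t x = 0) ->
    (forall t e x, E x -> 0 <= t -> 0 <= e -> t + e <= T ->
      `|f (t + e) x - f t x - e * generator (f t) x| <= K * e ^+ 2) ->
    0 <= h -> q * h <= 1 ->
  forall n, n%:R * h <= T ->
  forall x, `|survival E h n x - f (n%:R * h) x| <=
    n%:R * (K + q ^+ 2) * h ^+ 2.
Proof.
move=> K0 f0 fE fK h0 qh1; elim=> [|n IH] nT x.
  by rewrite !mul0r /= f0 subrr normr0.
have nh0 : 0 <= n%:R * h by rewrite mulr_ge0.
have nS : n.+1%:R * h = n%:R * h + h by rewrite -natr1; ring.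
have {}IH := IH (le_trans _ nT).
have {}IH := IH (ltac:(by rewrite nS lerDl)).
set e := n%:R * (K + q ^+ 2) * h ^+ 2 in IH *.
have e0 : 0 <= e by rewrite !mulr_ge0// ?exprn_ge0// addr_ge0// exprn_ge0// (bound_ge0 x).
have -> : n.+1%:R * (K + q ^+ 2) * h ^+ 2 = e + q ^+ 2 * h ^+ 2 + K * h ^+ 2.
  by rewrite /e -natr1; ring.
have pos : 0 <= q ^+ 2 * h ^+ 2 + K * h ^+ 2.
  by rewrite addr_ge0 ?mulr_ge0 ?exprn_ge0// (bound_ge0 x).
have [Ex|nEx] := boolP (E x); last first.
  by rewrite /= (negbTE nEx) mul0r fE// subr0 normr0 -addrA addr_ge0.
rewrite /= Ex mul1r nS.
set u := survival E h n; set v := f (n%:R * h).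
have A := expect_step x h0 qh1 (fun y => survival01 E n y h0).
rewrite -/u in A.
have B : `|f (n%:R * h + h) x - v x - h * generator v x| <= K * h ^+ 2.
  by apply: fK => //; rewrite -nS.
(* The Euler step does not expand the error, because its diagonal coefficient
   is nonnegative for [q h <= 1]. *)
have D : `|u x + h * generator u x - (v x + h * generator v x)| <= e.
  have -> : u x + h * generator u x - (v x + h * generator v x) =
    (1 - (\sum_(y <- nbr x) rate x y) * h) * (u x - v x) +
    h * \sum_(y <- nbr x) rate x y * (u y - v y).
    have -> : \sum_(y <- nbr x) rate x y * (u y - v y) =
        \sum_(y <- nbr x) rate x y * u y - \sum_(y <- nbr x) rate x y * v y.
      by rewrite -sumrB; apply: eq_bigr => y _; ring.
    rewrite !generatorE; ring.
  have Q1 : 0 <= 1 - (\sum_(y <- nbr x) rate x y) * h.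
    by rewrite subr_ge0; apply: le_trans qh1; rewrite ler_wpM2r.
  apply: le_trans (ler_normD _ _) _.
  rewrite !normrM (ger0_norm Q1) (ger0_norm h0).
  have S1 : `|\sum_(y <- nbr x) rate x y * (u y - v y)| <=
      (\sum_(y <- nbr x) rate x y) * e.
    apply: le_trans (ler_norm_sum _ _ _) _; rewrite mulr_suml.
    apply: ler_sum => y _; rewrite normrM (ger0_norm (rate_ge0 _ _)).
    by rewrite ler_wpM2l.
  apply: le_trans (lerD (ler_wpM2l Q1 (IH x)) (ler_wpM2l h0 S1)) _.
  by rewrite le_eqVlt; apply/orP; left; apply/eqP; ring.
have := ler_normD (expect h u x - (u x + h * generator u x))
  (u x + h * generator u x - (v x + h * generator v x)).
have := ler_normB (expect h u x - (u x + h * generator u x) +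
  (u x + h * generator u x - (v x + h * generator v x)))
  (f (n%:R * h + h) x - v x - h * generator v x).
have -> : expect h u x - (u x + h * generator u x) +
  (u x + h * generator u x - (v x + h * generator v x)) -
  (f (n%:R * h + h) x - v x - h * generator v x) =
  expect h u x - f (n%:R * h + h) x by ring.
move: A B D; lra.
Qed.

End BoundedRates.

(** * From the Markov property to survival along the paths *)

Section Esum.
Context {R : realType} {T : choiceType}.
Implicit Types (a : T -> \bar R) (c : R).

(** One inequality suffices: applied to [c^-1] it gives the converse. *)
Lemma esumZl_le c a : 0 <= c -> (forall x, (0 <= a x)%E) ->
  (\esum_(x in [set: T]) (c%:E * a x) <= c%:E * \esum_(x in [set: T]) a x)%E.
Proof.
move=> c0 a0; apply: ge_ereal_sup => _ [B [finB _]] <-.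
rewrite -ge0_mule_fsumr//; apply: lee_wpmul2l; first by rewrite lee_fin.
by apply: esum_ge; exists B.
Qed.

Lemma esumZl c a : 0 <= c -> (forall x, (0 <= a x)%E) ->
  (\esum_(x in [set: T]) (c%:E * a x) = c%:E * \esum_(x in [set: T]) a x)%E.
Proof.
rewrite le_eqVlt => /predU1P[<- a0|c0 a0].
  by rewrite mul0e esum1// => x _; rewrite mul0e.
apply/eqP; rewrite eq_le (esumZl_le (ltW c0))//=.
have ci0 : 0 <= c^-1 by rewrite invr_ge0 ltW.
have ca0 x : (0 <= c%:E * a x)%E by rewrite mule_ge0// lee_fin ltW.
have := esumZl_le ci0 ca0.
under eq_esum do rewrite muleA -EFinM mulVf ?gt_eqF// mul1e.
have c0' : (0 <= c%:E)%E by rewrite lee_fin ltW.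
move=> /(lee_wpmul2l c0') H; apply: (le_trans H).
by rewrite muleA -EFinM divff ?gt_eqF// mul1e.
Qed.

End Esum.

Section PathProbabilities.
Context {R : realType} {S : countType} {d : measure_display}.
Context {Omega : measurableType d}.
Variables (P : probability Omega R).

Lemma measure_countable_bigcup (F : S -> set Omega) :
    (forall y, measurable (F y)) -> trivIset setT F ->
  P (\bigcup_y F y) = (\esum_(y in [set: S]) P (F y))%E.
Proof.
move=> mF tF.
pose F' n := if unpickle n is Some y then F y else set0.
have F'E y : F' (pickle y) = F y by rewrite /F' pickleK.
have -> : \bigcup_y F y = \bigcup_(n in pickle @` [set: S]) F' n.
  rewrite bigcup_image; apply: eq_bigcupr => y _; by rewrite F'E.
rewrite measure_bigcup.
- rewrite nneseries_esum// (_ : [set x | _] = pickle @` [set: S]); last first.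
    by apply/seteqP; split => n /=; [move/set_mem|move/mem_set].
  rewrite esum_image; last by move=> y z _ _; exact: (pcan_inj pickleK).
  by apply: eq_esum => y _; rewrite F'E.
- by move=> n [y _ <-]; rewrite F'E.
- move=> _ _ [y _ <-] [z _ <-]; rewrite !F'E => yz.
  by rewrite (tF y z).
Qed.

Variables (tp : R -> S -> S -> R) (X : R -> Omega -> S).
Variables (rate : S -> S -> R).
Hypothesis tpP : transition_function rate tp.
Hypothesis XP : ctmc_with tp P X.
Variable E : pred S.

Definition on_path h n (xs : nat -> S) : set Omega :=
  [set w | forall k, (k <= n)%N -> X (k%:R * h) w = xs k].

Definition stays h m n : set Omega :=
  [set w | forall k, (m <= k <= m + n)%N -> E (X (k%:R * h) w)].

Lemma measurable_on_path h n xs : 0 <= h -> measurable (on_path h n xs).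
Proof.
move=> h0.
rewrite (_ : on_path h n xs =
  \bigcap_(k in [set k | (k <= n)%N]) [set w | X (k%:R * h) w = xs k]).
  apply: bigcap_measurable; first by exists 0%N.
  by move=> k _; apply: (ctmc_measurable XP); rewrite mulr_ge0.
by apply/seteqP; split.
Qed.

Lemma measurable_stays h m n : 0 <= h -> measurable (stays h m n).
Proof.
move=> h0.
rewrite (_ : stays h m n = \bigcap_(k in [set k | (m <= k <= m + n)%N])
   \bigcup_(y in [set y | E y]) [set w | X (k%:R * h) w = y]).
  apply: bigcap_measurable; first by exists m; rewrite /= leqnn leq_addr.
  move=> k _; rewrite bigcup_mkcond; apply: countable_bigcupT_measurable => //.
  move=> y; case: ifP => // _.
  by apply: (ctmc_measurable XP); rewrite mulr_ge0.
apply/seteqP; split => w /= H k.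
  by move=> /H kE; exists (X (k%:R * h) w).
by move=> /H[y /= Ey ->].
Qed.

(** The Markov property is given for single trajectories; decomposing over the
    state at the next observation time extends it to staying in [E]. *)
Lemma on_path_staysE h m n xs : 0 < h ->
  P (on_path h m xs `&` stays h m n) =
  (P (on_path h m xs) * (survival tp E h n (xs m))%:E)%E.
Proof.
move=> h0; have h0' := ltW h0; elim: n m xs => [|n IH] m xs /=.
  case Em: (E (xs m)); last first.
    rewrite mule0 (_ : _ `&` _ = set0) ?measure0//.
    apply/seteqP; split => // w [/= pw sw].
    by have := sw m; rewrite addn0 leqnn pw// Em => /(_ isT).
  rewrite mule1; congr (P _); apply/setIidPl => w pw k /=.
  by rewrite addn0 -eqn_leq => /eqP <-; rewrite pw.
case Em: (E (xs m)); last first.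
  rewrite mul0r mule0 (_ : _ `&` _ = set0) ?measure0//.
  apply/seteqP; split => // w [/= pw sw].
  by have := sw m; rewrite leqnn leq_addr pw// Em => /(_ isT).
rewrite mul1r.
(* [ys y] is the trajectory [xs] up to step [m], prolonged by [y]. *)
pose ys y k := if (k <= m)%N then xs k else y.
have -> : on_path h m xs `&` stays h m n.+1 =
    \bigcup_y (on_path h m.+1 (ys y) `&` stays h m.+1 n).
  apply/seteqP; split => w.
    move=> [/= pw sw]; exists (X (m.+1%:R * h) w) => //; split.
      move=> k; rewrite leq_eqVlt ltnS /ys => /orP[/eqP ->|km].
        by rewrite ltnn.
      by rewrite km pw.
    by move=> k /andP[mk kn]; apply: sw; rewrite ltnW//= addnS -addSn.
  move=> [y _ [/= pw sw]]; split.
    by move=> k km; rewrite pw ?leqW// /ys km.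
  move=> k /andP[mk kn]; have [mk'|km] := ltnP m k.
    by apply: sw; rewrite mk' addSn -addnS.
  have -> : k = m by apply/eqP; rewrite eqn_leq km mk.
  by rewrite pw ?leqW// /ys leqnn.
rewrite measure_countable_bigcup; first last.
- move=> y z _ _ [w [[py _] [pz _]]].
  by have := py m.+1 (leqnn _); rewrite pz// /ys ltnn.
- by move=> y; apply: measurableI; [exact: measurable_on_path|exact: measurable_stays].
have [FE _] := expect_fin tpP (xs m) h0'
  (fun y => survival01 tpP E n y h0').
rewrite -FE.
have PpE y : P (on_path h m.+1 (ys y)) =
    (P (on_path h m xs) * (tp h (xs m) y)%:E)%E.
  have := @ctmc_markov _ _ _ _ _ _ _ XP m (fun k => k%:R * h) (ys y).
  rewrite mul0r lexx => /(_ isT) ->; last first.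
    by move=> k _; rewrite ltr_pM2r// ltr_nat.
  rewrite /ys ltnn leqnn -mulrBl -natrB// subSnn mul1r; congr (P _ * _)%E.
  by apply/seteqP; split => w pw k km; have := pw k km; rewrite km.
have fP : P (on_path h m xs) \is a fin_num.
  by apply: fin_num_measure; exact: measurable_on_path.
have rv0 y : (0 <= (tp h (xs m) y * survival tp E h n y)%:E)%E.
  rewrite lee_fin mulr_ge0 ?(tf_ge0 tpP)//.
  by case/andP: (survival01 tpP E n y h0').
rewrite -(fineK fP) -esumZl ?fine_ge0//; apply: eq_esum => y _.
by rewrite IH PpE /ys ltnn -(fineK fP) EFinM muleA.
Qed.

End PathProbabilities.

Section ContinuousSurvival.
Context {R : realType} {S : countType} {d : measure_display}.
Context {Omega : measurableType d}.
Variables (P : probability Omega R).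
Variables (tp : R -> S -> S -> R) (X : R -> Omega -> S).
Variables (rate : S -> S -> R) (nbr : S -> seq S) (q : R).
Hypothesis tpP : transition_function rate tp.
Hypothesis XP : ctmc_with tp P X.
Hypothesis nbr_uniq : forall x, uniq (x :: nbr x).
Hypothesis rate_ge0 : forall x y, 0 <= rate x y.
Hypothesis rate_out : forall x y, x != y -> y \notin nbr x -> rate x y = 0.
Hypothesis rate_le : forall x, \sum_(y <- nbr x) rate x y <= q.
Variable E : pred S.
Variables (t : R) (t_gt0 : 0 < t).

Let step m : R := t / 2 ^+ m.

Let step_gt0 m : 0 < step m.
Proof. by rewrite divr_gt0// exprn_gt0. Qed.

Lemma cvg_dyadic_step : t / 2 ^+ m @[m --> \oo] --> (0 : R).
Proof.
rewrite -(mulr0 t); apply: cvgM; first exact: cvg_cst.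
rewrite (_ : (fun n => (2 ^+ n)^-1) = (fun n => 2^-1 ^+ n)).
  by apply: cvg_expr; rewrite ger0_norm ?invr_ge0// invf_lt1 ?ltr1n.
by apply/funext => n; rewrite exprVn.
Qed.

Definition stays_before : set Omega :=
  [set w | forall s, 0 <= s < t -> E (X s w)].

(** If the path leaves [E] at time [s], by right-continuity it is still out at
    all slightly later times, in particular at some dyadic multiple of [t]
    below [t]. *)
Lemma stays_beforeE :
  stays_before = \bigcap_m stays X E (step m) 0 (2 ^ m).-1.
Proof.
apply/seteqP; split => w /=.
  move=> H m _ k /andP[_]; rewrite add0n => km; apply: H.
  apply/andP; split; first by rewrite mulr_ge0// ltW.
  rewrite /step mulrA ltr_pdivrMr ?exprn_gt0// mulrC ltr_pM2l//.
  by rewrite -natrX ltr_nat -(prednK (expn_gt0 2 m)).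
move=> H s /andP[s0 st]; apply/negPn/negP => nEs.
have := ctmc_right_continuous XP w s0.
move=> [e /= e0 He].
have [m] : exists m, step m < Num.min e (t - s).
  have me : 0 < Num.min e (t - s) by rewrite lt_min e0 subr_gt0.
  have /cvgrPdist_lt/(_ _ me)[N _ HN] := cvg_dyadic_step.
  exists N; have := HN N (leqnn _); rewrite /= sub0r normrN.
  by apply: le_lt_trans; rewrite ler_norm.
rewrite lt_min => /andP[me mts].
have sm0 : 0 <= s / step m by rewrite divr_ge0// ltW.
have := truncn_itv sm0; set k := Num.truncn _.
rewrite ler_pdivlMr// ltr_pdivrMr// => /andP[ks sk].
have ksS : k.+1%:R * step m = k%:R * step m + step m by rewrite -natr1; ring.
have kt : (k.+1%:R * step m < t) by rewrite ksS; lra.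
have kk : (0 <= k.+1 <= 0 + (2 ^ m).-1)%N.
  rewrite add0n /= -ltnS prednK ?expn_gt0//.
  move: kt; rewrite /step mulrA ltr_pdivrMr ?exprn_gt0// mulrC ltr_pM2l//.
  by rewrite -natrX ltr_nat.
have := H m I k.+1 kk; rewrite He ?(negbTE nEs)//=.
by rewrite ltr0_norm ?subr_lt0// opprB ksS; lra.
Qed.

Variables (f : R -> S -> R) (K : R).
Hypothesis K_ge0 : 0 <= K.
Hypothesis f0 : forall x, f 0 x = (E x)%:R.
Hypothesis f_out : forall s x, ~~ E x -> f s x = 0.
Hypothesis f_cont : forall x, {for t, continuous (f ^~ x)}.
Hypothesis f_taylor : forall s e x, E x -> 0 <= s -> 0 <= e -> s + e <= t ->
  `|f (s + e) x - f s x - e * generator rate nbr (f s) x| <= K * e ^+ 2.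

(** The [2 ^ m] steps have length [t / 2 ^ m] and a local error of the order of
    the square of this length. *)
Lemma cvg_survival x :
  survival tp E (t / 2 ^+ m) (2 ^ m).-1 x @[m --> \oo] --> f t x.
Proof.
have stepE m : (2 ^ m).-1%:R * step m = t - step m.
  rewrite -subn1 natrB ?expn_gt0// natrX mulrBl mul1r /step; congr (_ - _).
  by rewrite mulrCA divff ?mulr1// expf_neq0.
have ct : t - step m @[m --> \oo] --> t.
  suff : t - step m @[m --> \oo] --> t - 0 by rewrite subr0.
  by apply: cvgB; [exact: cvg_cst|exact: cvg_dyadic_step].
have cf : f (t - step m) x @[m --> \oo] --> f t x.
  exact: (continuous_cvg _ (f_cont (x := x)) ct).
suff: survival tp E (t / 2 ^+ m) (2 ^ m).-1 x - f (t - step m) x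
    @[m --> \oo] --> 0 by move=> /cvg_sub0; exact.
apply/cvgr0Pnorm_le => e e0.
have c1 : step m * (t * (K + q ^+ 2)) @[m --> \oo] --> 0.
  rewrite -(mul0r (t * (K + q ^+ 2))).
  by apply: cvgM; [exact: cvg_dyadic_step|exact: cvg_cst].
have c2 : q * step m @[m --> \oo] --> 0.
  rewrite -(mulr0 q).
  by apply: cvgM; [exact: cvg_cst|exact: cvg_dyadic_step].
near=> m.
have qm : q * step m <= 1.
  near: m; by apply: (cvgr_le _ c2); exact: ltr01.
have em : step m * (t * (K + q ^+ 2)) <= e.
  near: m; by apply: (cvgr_le _ c1); exact: e0.
rewrite -stepE.
have := survival_approx tpP nbr_uniq rate_ge0 rate_out rate_le K_ge0 f0 f_out
  f_taylor (ltW (step_gt0 m)) qm (n := (2 ^ m).-1).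
rewrite stepE => H; apply: le_trans (H _ x) _; first by rewrite gerBl ltW.
apply: le_trans em.
have -> : (2 ^ m).-1%:R * (K + q ^+ 2) * step m ^+ 2 =
  ((2 ^ m).-1%:R * step m) * ((K + q ^+ 2) * step m) by ring.
rewrite stepE.
have -> : step m * (t * (K + q ^+ 2)) = t * ((K + q ^+ 2) * step m) by ring.
apply: ler_wpM2r; last by rewrite gerBl ltW.
by rewrite mulr_ge0 ?addr_ge0 ?exprn_ge0 ?(bound_ge0 rate_ge0 rate_le x)// ltW.
Unshelve. all: by end_near. Qed.

(** Refining the dyadic grid makes the discrete survival events decrease to
    [stays_before], so that continuity from above applies. *)
Lemma stays_before_prob x :
  P ([set w | X 0 w = x] `&` stays_before) =
  (P [set w | X 0 w = x] * (f t x)%:E)%E.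
Proof.
pose C m := on_path X (step m) 0 (fun=> x) `&` stays X E (step m) 0 (2 ^ m).-1.
have on0 m : on_path X (step m) 0 (fun=> x) = [set w | X 0 w = x].
  apply/seteqP; split => w /=; first by move=> /(_ 0%N (leqnn _)); rewrite mul0r.
  by move=> Xw k; rewrite leqn0 => /eqP ->; rewrite mul0r.
have mC m : measurable (C m).
  apply: measurableI; first by apply: (measurable_on_path XP); rewrite ltW.
  by apply: (measurable_stays XP); rewrite ltW.
have CE : \bigcap_m C m = [set w | X 0 w = x] `&` stays_before.
  rewrite stays_beforeE -bigcapIr; last by exists 0%N.
  by apply: eq_bigcapr => m _; rewrite /C on0.
have niC : nonincreasing_seq C.
  apply/nonincreasing_seqP => m; apply/subsetPset.
  rewrite /C !on0; apply: setIS => w /= H k /andP[_].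
  rewrite add0n => km; have := H k.*2.
  have -> : k.*2%:R * step m.+1 = k%:R * step m.
    rewrite /step exprS -mul2n natrM; field.
    by rewrite expf_neq0.
  apply; rewrite add0n /= -ltnS prednK ?expn_gt0//.
  rewrite expnS -mul2n ltn_pmul2l//.
  by rewrite -(prednK (expn_gt0 2 m)).
have lim1 : P (C m) @[m --> \oo] --> P (\bigcap_m C m).
  apply: nonincreasing_cvg_mu => //.
    exact: (le_lt_trans (probability_le1 P (mC 0%N)) (ltry 1)).
  by apply: bigcap_measurable; [exists 0%N|].
have lim2 : P (C m) @[m --> \oo] --> (P [set w | X 0 w = x] * (f t x)%:E)%E.
  have -> : (fun m => P (C m)) = fun m => (P [set w | X 0 w = x] *
      (survival tp E (step m) (2 ^ m).-1 x)%:E)%E.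
    apply/funext => m.
    by rewrite /C (on_path_staysE tpP XP E 0 _ (fun=> x) (step_gt0 m)) on0.
  have fP : P [set w | X 0 w = x] \is a fin_num.
    by apply: fin_num_measure; exact: (ctmc_measurable XP).
  apply: cvgeZl => //; apply: cvg_EFin; first by near=> m.
  exact: cvg_survival.
by rewrite -CE; exact: (cvg_unique _ lim1 lim2).
Unshelve. all: by end_near. Qed.

End ContinuousSurvival.

(** * The semigroup of the chain killed outside a set *)

Section KilledSemigroup.
Context {R : realType} {S : countType}.
Variables (rate : S -> S -> R) (nbr : S -> seq S) (q : R).
Hypothesis rate_ge0 : forall x y, 0 <= rate x y.
Hypothesis rate_le : forall x, \sum_(y <- nbr x) rate x y <= q.
Variable E : pred S.
Implicit Types (x y : S) (g : S -> R) (C t : R).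

Definition killed g x := (E x)%:R * generator rate nbr g x.

(** [exp (t * killed) g], as a power series in [t]. *)
Definition killed_semigroup g t x := egf (fun n => iter n killed g x) t.

Lemma killed_le C g : (forall x, `|g x| <= C) ->
  forall x, `|killed g x| <= C * (2 * q).
Proof.
move=> gC x; have C0 : 0 <= C := le_trans (normr_ge0 _) (gC x).
have rq := rate_le x.
have r0 : 0 <= \sum_(y <- nbr x) rate x y by exact: sumr_ge0.
rewrite /killed normrM; case: (E x); last first.
  by rewrite normr0 mul0r; nra.
rewrite normr1 mul1r; apply: le_trans (ler_norm_sum _ _ _) _.
apply: (@le_trans _ _ (\sum_(y <- nbr x) rate x y * (2 * C))).
  apply: ler_sum => y _; rewrite normrM (ger0_norm (rate_ge0 _ _)) ler_wpM2l//.
  by apply: le_trans (ler_normB _ _) _; have := gC x; have := gC y; lra.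
rewrite -mulr_suml; nra.
Qed.

Lemma killed_geo C g x : (forall x, `|g x| <= C) ->
  geo_bounded C (2 * q) (fun n => iter n killed g x).
Proof.
move=> gC n; elim: n x => [|n IH] x /=; first by rewrite mulr1.
by apply: le_trans (killed_le IH x) _; rewrite exprS -!mulrA [_ ^+ _ * _]mulrC !mulrA.
Qed.

Lemma killed_growth_ge0 x : 0 <= 2 * q.
Proof.
rewrite mulr_ge0//; apply: le_trans (rate_le x); exact: sumr_ge0.
Qed.

Lemma killed_semigroup0 g x : killed_semigroup g 0 x = g x.
Proof. by rewrite /killed_semigroup egf0. Qed.

(** The neighbours are finitely many, so [killed] acts on the series term by
    term. *)
Lemma killed_semigroup_comm C g t x : (forall x, `|g x| <= C) ->
  killed (killed_semigroup g t) x = killed_semigroup (killed g) t x.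
Proof.
move=> gC; have gG y := killed_geo y gC.
have [[C' SB] SE] := egf_sum (nbr x) (rate x) t gG.
rewrite /killed generatorE -SE /killed_semigroup.
have -> : (fun n => iter n killed (killed g) x) = fun n =>
    (E x)%:R * (\sum_(y <- nbr x) rate x y * iter n killed g y) +
    (- (E x)%:R * \sum_(y <- nbr x) rate x y) * iter n killed g x.
  apply/funext => n; rewrite -iterSr iterS {1}/killed generatorE; ring.
by rewrite (egf_lin _ _ _ SB (gG x)); ring.
Qed.

Lemma killed_semigroup_derive C g t x : (forall x, `|g x| <= C) ->
  is_derive t 1 (killed_semigroup g ^~ x) (killed (killed_semigroup g t) x).
Proof.
move=> gC; rewrite (killed_semigroup_comm _ _ gC).
have := egf_is_derive t (killed_geo x gC).
rewrite /killed_semigroup.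
by under [in X in is_derive _ _ _ X]eq_fun do rewrite iterSr.
Qed.

Lemma killed_semigroup_le C g t x : (forall x, `|g x| <= C) ->
  `|killed_semigroup g t x| <= C * expR (2 * q * `|t|).
Proof. by move=> gC; apply: egf_le; exact: killed_geo. Qed.

Lemma killed_semigroup_out g t x : (forall x, ~~ E x -> g x = 0) -> ~~ E x ->
  killed_semigroup g t x = 0.
Proof.
move=> g0 nEx.
have -> : killed_semigroup g t x = egf (fun n => 0) t.
  congr egf; apply/funext => -[|n]/=; first exact: g0.
  by rewrite /killed (negbTE nEx) mul0r.
apply/eqP; rewrite -normr_le0; apply: le_trans (egf_le (C := 0) (M := 0) _ _) _.
  by move=> n; rewrite normr0 mul0r.
by rewrite mul0r.
Qed.

Lemma killed_semigroup_taylor C g s e x T : (forall x, `|g x| <= C) ->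
    0 <= s -> 0 <= e -> s + e <= T -> E x ->
  `|killed_semigroup g (s + e) x - killed_semigroup g s x -
     e * generator rate nbr (killed_semigroup g s) x| <=
  C * (2 * q) ^+ 2 * expR (2 * q * T) * e ^+ 2.
Proof.
move=> gC s0 e0 seT Ex; have M0 := killed_growth_ge0 x.
have C0 : 0 <= C := le_trans (normr_ge0 _) (gC x).
have := egf_taylor M0 (killed_geo x gC) s0 e0.
have -> : egf (fun n => iter n.+1 killed g x) s =
    generator rate nbr (killed_semigroup g s) x.
  have := killed_semigroup_comm s x gC; rewrite {1}/killed Ex mul1r => ->.
  by congr egf; apply/funext => n; rewrite iterSr.
move/le_trans; apply; rewrite ler_wpM2r ?exprn_ge0// ler_wpM2l//.
  by rewrite mulr_ge0// exprn_ge0.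
by rewrite ler_expR ler_wpM2l.
Qed.

End KilledSemigroup.

(** * Weighted walks and Bessel functions *)

Section Walk.
Context {R : realType}.
Variables (lam mu : R).
Hypotheses (lam_gt0 : 0 < lam) (mu_gt0 : 0 < mu).
Implicit Types (n u d : nat) (v : int) (t : R).

(** The coefficient of [z ^ v] in [(lam * z + mu / z) ^ n], that is, the weighted
    number of [n]-step nearest-neighbour walks from 0 to [v].  The generating
    function of Bessel functions is the exponential of [t * (lam * z + mu / z)],
    whence [walk_egf_bessel]. *)
Fixpoint walk n v : R :=
  if n is m.+1 then lam * walk m (v - 1) + mu * walk m (v + 1)
  else (v == 0)%:R.

(** A walk with [u] steps up and [d] steps down ends at [u - d].  This single
    criterion covers both the range and the parity of the endpoint. *)
Lemma walk_out n v :
  (forall u d, n = (u + d)%N -> v = u%:Z - d%:Z -> False) -> walk n v = 0.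
Proof.
elim: n v => [|n IH] v H /=.
  by case: eqP => // v0; case: (H 0%N 0%N); rewrite ?v0.
rewrite !IH ?mulr0 ?addr0// => u d E1 E2.
  by apply: (H u d.+1); lia.
by apply: (H u.+1 d); lia.
Qed.

Lemma walk_binomial u d :
  walk (u + d) (u%:Z - d%:Z) = 'C(u + d, u)%:R * lam ^+ u * mu ^+ d.
Proof.
move: {2}(u + d)%N (erefl (u + d)%N) => n; elim: n u d => [|n IH] u d E.
  have [-> ->] : u = 0%N /\ d = 0%N by lia.
  by rewrite /= bin0 !mulr1.
rewrite E /=.
have up : lam * walk n (u%:Z - d%:Z - 1) =
    (if u is u'.+1 then 'C(n, u')%:R else 0) * lam ^+ u * mu ^+ d.
  case: u E => [|u] E.
    by rewrite walk_out ?mulr0 ?mul0r// => a b; lia.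
  have -> : u.+1%:Z - d%:Z - 1 = u%:Z - d%:Z by lia.
  have En : n = (u + d)%N by lia.
  by rewrite {1}En IH// -En exprS; ring.
have dn : mu * walk n (u%:Z - d%:Z + 1) =
    (if d is d'.+1 then 'C(n, u)%:R else 0) * lam ^+ u * mu ^+ d.
  case: d E {up} => [|d] E.
    by rewrite walk_out ?mulr0 ?mul0r// => a b; lia.
  have -> : u%:Z - d.+1%:Z + 1 = u%:Z - d%:Z by lia.
  have En : n = (u + d)%N by lia.
  by rewrite {1}En IH// -En exprS; ring.
rewrite up dn; case: u d E {up dn} => [|u] [|d] E.
- by [].
- by rewrite !bin0; ring.
- have -> : n = u by lia.
  by rewrite !binn; ring.
- by rewrite binS natrD; ring.
Qed.

Lemma walk_ge0 n v : 0 <= walk n v.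
Proof.
by elim: n v => [|n IH] v //=; rewrite addr_ge0// mulr_ge0// ltW.
Qed.

Lemma walk_le n v : walk n v <= (lam + mu) ^+ n.
Proof.
elim: n v => [|n IH] v /=; first by rewrite expr0; case: (v == 0).
by rewrite exprS mulrDl lerD// ler_pM2l.
Qed.

(** The factor [2^-1 ^+ `|v|] is free: a walk needs [`|v|] steps to reach [v],
    so it is paid for by doubling the growth rate.  It gives the decay in [v]
    that kills the boundary term of the Duhamel formula. *)
Lemma walk_geo v : geo_bounded (2^-1 ^+ `|v|%N) (2 * (lam + mu)) (walk ^~ v).
Proof.
move=> n; rewrite ger0_norm ?walk_ge0//.
have lm0 : 0 < lam + mu by rewrite addr_gt0.
have [nv|vn] := ltnP n `|v|%N.
  rewrite walk_out; last by move=> u d; lia.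
  by rewrite mulr_ge0 ?exprn_ge0 ?invr_ge0// mulr_ge0// ltW.
apply: le_trans (walk_le n v) _.
rewrite exprMn mulrA ler_peMl ?exprn_ge0 ?(ltW lm0)//.
rewrite exprVn mulrC ler_pdivlMr ?exprn_gt0// mul1r.
by rewrite ler_eXn2l// ltr1n.
Qed.

(** Reflecting a walk exchanges steps up and down. *)
Lemma walk_opp n v : walk n (- v) = (mu / lam) ^ v * walk n v.
Proof.
have r0 : mu / lam != 0 by rewrite mulf_neq0 ?invr_eq0 ?gt_eqF.
elim: n v => [|n IH] v /=.
  by rewrite oppr_eq0; case: eqP => [->|_]; rewrite ?expr0z ?mulr1 ?mulr0.
have -> : - v - 1 = - (v + 1) by lia.
have -> : - v + 1 = - (v - 1) by lia.
rewrite !IH !expfzDr// expr1z.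
have -> : (mu / lam) ^ (-1) = lam / mu by rewrite exprN1 invf_div.
by field; rewrite !gt_eqF.
Qed.

(** The Euler operator [z d/dz] applied to [(lam * z + mu / z) ^ n.+1].  For
    Bessel functions this is [I_(v - 1) - I_(v + 1) = (2 v / x) * I_v]. *)
Lemma walk_drift n v : v%:~R * walk n.+1 v =
  n.+1%:R * (lam * walk n (v - 1) - mu * walk n (v + 1)).
Proof.
elim: n v => [|n IH] v.
  rewrite mul1r; have [->|v1] := eqVneq v 1; first by rewrite /=; ring.
  have [->|v2] := eqVneq v (-1); first by rewrite rmorphN1 /=; ring.
  by rewrite /= subr_eq0 (negbTE v1) addr_eq0 (negbTE v2) !mulr0 subrr addr0 mulr0.
have := IH (v - 1); have := IH (v + 1).
rewrite addrK subrK rmorphB rmorphD rmorph1.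
have -> : walk n.+2 v = lam * walk n.+1 (v - 1) + mu * walk n.+1 (v + 1) by [].
have Ea : walk n.+1 (v - 1) = lam * walk n (v - 1 - 1) + mu * walk n v.
  by rewrite /= subrK.
have Eb : walk n.+1 (v + 1) = lam * walk n v + mu * walk n (v + 1 + 1).
  by rewrite /= addrK.
set a := walk n.+1 (v - 1) in Ea *; set b := walk n.+1 (v + 1) in Eb *.
move=> IH2 IH1.
have -> : v%:~R * (lam * a + mu * b) =
  lam * ((v%:~R - 1) * a) + mu * ((v%:~R + 1) * b) + lam * a - mu * b by ring.
rewrite IH1 IH2 -[n.+2%:R]natr1 Ea Eb; ring.
Qed.

Definition walk_egf v t := egf (walk ^~ v) t.

Lemma walk_egf_derive v t : is_derive t 1 (walk_egf v)
  (lam * walk_egf (v - 1) t + mu * walk_egf (v + 1) t).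
Proof.
have := egf_is_derive t (walk_geo v).
by rewrite /= (egf_lin _ _ _ (walk_geo (v - 1)) (walk_geo (v + 1))).
Qed.

Lemma walk_egf0 v : walk_egf v 0 = (v == 0)%:R.
Proof. by rewrite /walk_egf egf0. Qed.

Lemma walk_egf_le v t :
  `|walk_egf v t| <= 2^-1 ^+ `|v|%N * expR (2 * (lam + mu) * `|t|).
Proof. exact: egf_le (walk_geo v). Qed.

Lemma walk_egf_opp v t : walk_egf (- v) t = (mu / lam) ^ v * walk_egf v t.
Proof.
rewrite /walk_egf -(egf_scale _ _ (walk_geo v)); congr egf.
by apply/funext => n; exact: walk_opp.
Qed.

Lemma walk_egf_drift v t : v%:~R * walk_egf v t =
  t * (lam * walk_egf (v - 1) t - mu * walk_egf (v + 1) t).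
Proof.
pose c n := lam * walk n (v - 1) + (- mu) * walk n (v + 1).
have -> : lam * walk_egf (v - 1) t - mu * walk_egf (v + 1) t = egf c t.
  by rewrite (egf_lin _ _ _ (walk_geo (v - 1)) (walk_geo (v + 1))) mulNr.
rewrite -(egf_scale _ _ (walk_geo v)).
have cvc : cvgn (pseries (fun n => c n / n`!%:R) t).
  have M0 : 0 <= 2 * (lam + mu) by rewrite mulr_ge0// addr_ge0// ltW.
  apply: (@egf_cvg _ (lam + mu) (2 * (lam + mu))) => n.
  apply: le_trans (ler_normD _ _) _.
  rewrite !normrM normrN (gtr0_norm lam_gt0) (gtr0_norm mu_gt0) mulrDl.
  have h w : `|walk n w| <= (2 * (lam + mu)) ^+ n.
    apply: le_trans (walk_geo w n) _; rewrite ler_piMl ?exprn_ge0//.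
    by rewrite exprn_ile1 ?invr_ge0// invf_le1// ler1n.
  by rewrite lerD// ler_wpM2l ?h// ltW.
have lim : t * pseries (fun n => c n / n`!%:R) t n @[n --> \oo] --> t * egf c t.
  by apply: cvgM; [exact: cvg_cst|exact: cvc].
apply: cvg_lim => //.
rewrite -cvg_shiftS /=.
have -> : (fun n => pseries (fun n => v%:~R * walk n v / n`!%:R) t n.+1) =
   (fun n => t * pseries (fun n => c n / n`!%:R) t n).
  apply/funext => n; rewrite /pseries /series /= big_nat_recl//=.
  rewrite [X in X + _](_ : _ = 0) ?add0r; last first.
    by rewrite fact0; case: eqP => [->|_]; rewrite ?mul0r ?mulr0 ?mul0r.
  rewrite mulr_sumr; apply: eq_bigr => i _.
  rewrite -/(walk i.+1 v) walk_drift factS natrM exprS /c.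
  by field; rewrite nat1r !pnatr_eq0 -lt0n fact_gt0.
exact: lim.
Qed.

End Walk.

Section Bessel.
Context {R : realType}.
Variables (lam mu : R).
Hypotheses (lam_gt0 : 0 < lam) (mu_gt0 : 0 < mu).
Implicit Types (n u d i : nat) (v : int) (t : R).

(** The factor [(lam / mu) ^ (v / 2)] with [v = u - d] redistributes the weight
    [(lam mu) ^ ((u + d) / 2)] of the Bessel series between the [u] steps up
    and the [d] steps down. *)
Lemma bessel_weight u d :
  (lam / mu) `^ ((u%:Z - d%:Z)%:~R / 2) * Num.sqrt (lam * mu) ^+ (u + d) =
  lam ^+ u * mu ^+ d.
Proof.
have lm0 : 0 <= lam / mu by rewrite ltW// divr_gt0.
have sl : Num.sqrt lam != 0 by rewrite gt_eqF// sqrtr_gt0.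
have sm : Num.sqrt mu != 0 by rewrite gt_eqF// sqrtr_gt0.
rewrite [_ / 2]mulrC powRrM powR12_sqrt// powR_intmul ?sqrtr_ge0//.
rewrite !sqrtrM ?sqrtrV ?(ltW lam_gt0) ?(ltW mu_gt0)//.
rewrite expfzDr ?mulf_neq0 ?invr_eq0// -exprnN -exprnP.
have -> : lam ^+ u = Num.sqrt lam ^+ u * Num.sqrt lam ^+ u.
  by rewrite -exprMn -expr2 sqr_sqrtr// ltW.
have -> : mu ^+ d = Num.sqrt mu ^+ d * Num.sqrt mu ^+ d.
  by rewrite -exprMn -expr2 sqr_sqrtr// ltW.
rewrite !exprMn !exprVn !exprD.
by field; rewrite !expf_neq0.
Qed.

(** The Bessel series lists the walks by their number [m] of steps down, so its
    [m]-th term is the term of degree [2 m + v] of the exponential generating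
    function; the other degrees have the wrong parity.  The first
    [max (0, - v)] terms of the Bessel series vanish, and so do the first
    [`|v|] terms on the other side. *)
Lemma walk_egf_bessel v t :
  (lam / mu) `^ (v%:~R / 2) * besselI v (2 * t * Num.sqrt (lam * mu)) =
  walk_egf lam mu v t.
Proof.
(* [v = u0 - d0], with [u0 = 0] or [d0 = 0]: the shortest walk to [v]. *)
pose u0 : nat := if (0 <= v)%R then `|v|%N else 0%N.
pose d0 : nat := if (0 <= v)%R then 0%N else `|v|%N.
have vE : v = u0%:Z - d0%:Z by rewrite /u0 /d0; case: ifP; lia.
have ud0 : (u0 + d0)%N = `|v|%N by rewrite /u0 /d0; case: ifP; lia.
have u0d0 : u0 = 0%N \/ d0 = 0%N by rewrite /u0 /d0; case: ifP; [right|left].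
set c := _ `^ _.
have c0 : c != 0 by rewrite gt_eqF// powR_gt0// divr_gt0.
pose T m := (2 * t * Num.sqrt (lam * mu) / 2) ^ ((2 * m)%:Z + v) *
  (m`!%:R)^-1 * invGammaS (m%:Z + v).
pose W n := walk lam mu n v / n`!%:R * t ^+ n.
have W0 n : (forall u d, n = (u + d)%N -> v = u%:Z - d%:Z -> False) -> W n = 0.
  by move=> H; rewrite /W walk_out// !mul0r.
have term i : c * T (d0 + i)%N = W (`|v| + i.*2)%N.
  rewrite /T /W.
  have -> : (`|v| + i.*2)%N = ((u0 + i) + (d0 + i))%N by lia.
  have -> : (2 * (d0 + i))%N%:Z + v = ((u0 + i) + (d0 + i))%N%:Z by lia.
  have -> : (d0 + i)%N%:Z + v = (u0 + i)%N%:Z by lia.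
  have vi : v = (u0 + i)%N%:Z - (d0 + i)%N%:Z by lia.
  have -> : walk lam mu (u0 + i + (d0 + i)) v =
      'C(u0 + i + (d0 + i), u0 + i)%:R * lam ^+ (u0 + i) * mu ^+ (d0 + i).
    by rewrite {1}vi walk_binomial.
  have -> : c = (lam / mu) `^ (((u0 + i)%N%:Z - (d0 + i)%N%:Z)%:~R / 2).
    by rewrite -vi.
  rewrite -exprnP /=.
  have -> : 2 * t * Num.sqrt (lam * mu) / 2 = Num.sqrt (lam * mu) * t by field.
  rewrite exprMn.
  set U := (u0 + i)%N; set D := (d0 + i)%N.
  have F : 'C(U + D, U)%:R * (U`!%:R * D`!%:R) = (U + D)`!%:R :> R.
    by rewrite -!natrM -(bin_fact (leq_addr D U)) addKn.
  have := bessel_weight U D; rewrite -F => BW.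
  have -> : 'C(U + D, U)%:R * lam ^+ U * mu ^+ D /
    ('C(U + D, U)%:R * (U`!%:R * D`!%:R)) * t ^+ (U + D) =
    lam ^+ U * mu ^+ D / (U`!%:R * D`!%:R) * t ^+ (U + D) :> R.
    field; rewrite !pnatr_eq0 -!lt0n !fact_gt0 bin_gt0 leq_addr //.
  rewrite -BW; field; rewrite !pnatr_eq0 -!lt0n !fact_gt0 //.
have part i : c * series T (d0 + i)%N = series W (`|v| + i.*2)%N.
  elim: i => [|i IH].
    rewrite !addn0 /series /= big_nat_cond big1 ?mulr0; last first.
      move=> m /andP[/andP[_ md] _].
      have d00 : u0 = 0%N by lia.
      have iG : invGammaS (m%:Z + v) = 0 :> R by case E : (m%:Z + v) => //; lia.
      by rewrite /T iG mulr0.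
    rewrite big_nat_cond big1// => n /andP[/andP[_ nv] _].
    by apply: W0 => u d; lia.
  have -> : (`|v| + i.+1.*2)%N = (`|v| + i.*2).+2 by lia.
  rewrite addnS /series /= !big_nat_recr//= mulrDr term.
  rewrite [W (_ + _).+1]W0 ?addr0; last by move=> u d; lia.
  by congr (_ + _); exact: IH.
have cW : series W n @[n --> \oo] --> walk_egf lam mu v t.
  exact: (@egf_cvg _ _ _ _ t (walk_geo lam_gt0 mu_gt0 v)).
have cT : c * series T n @[n --> \oo] --> walk_egf lam mu v t.
  rewrite -(cvg_shiftn d0).
  have -> : (fun n => c * series T (n + d0)%N) =
      (series W) \o (fun i => `|v| + i.*2)%N.
    by apply/funext => n /=; rewrite addnC part.
  apply: (cvg_comp _ _ _ cW).
  move=> A [N _ HN]; exists N => // n /= Nn; apply: HN => /=; lia.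
have cT' : series T n @[n --> \oo] --> c^-1 * walk_egf lam mu v t.
  have -> : series T = fun n => c^-1 * (c * series T n).
    by apply/funext => n; rewrite mulKf.
  by apply: cvgM; [exact: cvg_cst|exact: cT].
rewrite /besselI -/T (cvg_lim _ cT')//.
by rewrite mulrA divff// mul1r.
Qed.

End Bessel.

(** * The M/M/1 queue avoiding zero *)

Section Taboo.
Context {R : realType}.
Variables (lam mu : R).
Hypotheses (lam_gt0 : 0 < lam) (mu_gt0 : 0 < mu).
Implicit Types (j k : nat) (t : R).
Let B v t := walk_egf lam mu v t.

(** Reflection principle: the walks from [j] to [k] that touch zero are those
    from [- j] to [k], up to the weight [(mu / lam) ^ j] of reflecting the part
    before the first visit to zero. *)
Definition taboo j k t : R := expR (- (lam + mu) * t) *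
  (B (k%:Z - j%:Z) t - (mu / lam) ^+ j * B (k%:Z + j%:Z) t).

Lemma alphahatE j k t : alphahat lam mu j k t = taboo j k t.
Proof.
rewrite /alphahat /taboo /B -!walk_egf_bessel//.
have lm : lam / mu != 0 by rewrite gt_eqF// divr_gt0.
have -> : (k%:Z - j%:Z)%:~R = k%:R - j%:R :> R by rewrite rmorphB.
have -> : (k%:Z + j%:Z)%:~R = k%:R + j%:R :> R by rewrite rmorphD.
have -> : (k%:R + j%:R) / 2 = (k%:R - j%:R) / 2 + j%:R :> R by field.
rewrite powRD; last by apply/implyP.
rewrite powR_mulrn ?divr_ge0 ?ltW//.
have -> : (mu / lam) ^+ j * ((lam / mu) `^ ((k%:R - j%:R) / 2) *
  (lam / mu) ^+ j * besselI (k%:Z + j%:Z) (2 * t * Num.sqrt (lam * mu))) =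
  ((mu / lam) * (lam / mu)) ^+ j * ((lam / mu) `^ ((k%:R - j%:R) / 2) *
   besselI (k%:Z + j%:Z) (2 * t * Num.sqrt (lam * mu))).
  rewrite [(mu / lam * (lam / mu)) ^+ j]exprMn; ring.
have -> : mu / lam * (lam / mu) = 1 by field; rewrite !gt_eqF.
rewrite expr1n; ring.
Qed.

Lemma taboo_init j k : (0 < j)%N -> taboo j k 0 = (k == j)%:R.
Proof.
move=> j0; rewrite /taboo /B mulr0 expR0 mul1r !walk_egf0 subr_eq0.
have -> : (k%:Z + j%:Z == 0) = false by lia.
by rewrite mulr0 subr0 eqz_nat.
Qed.

Lemma taboo_at0 j t : taboo j 0 t = 0.
Proof.
by rewrite /taboo sub0r add0r /B walk_egf_opp// -exprnP subrr mulr0.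
Qed.

Lemma taboo_derive j k t : is_derive t 1 (taboo j k.+1)
  (lam * taboo j k t + mu * taboo j k.+2 t - (lam + mu) * taboo j k.+1 t).
Proof.
have D1 := walk_egf_derive lam_gt0 mu_gt0 (k.+1%:Z - j%:Z) t.
have D2 := walk_egf_derive lam_gt0 mu_gt0 (k.+1%:Z + j%:Z) t.
rewrite /taboo /B; apply: is_derive_eq.
rewrite /GRing.scale/=.
have -> : k.+1%:Z - j%:Z - 1 = k%:Z - j%:Z by lia.
have -> : k.+1%:Z - j%:Z + 1 = k.+2%:Z - j%:Z by lia.
have -> : k.+1%:Z + j%:Z - 1 = k%:Z + j%:Z by lia.
have -> : k.+1%:Z + j%:Z + 1 = k.+2%:Z + j%:Z by lia.
ring.
Qed.

(** Zero is reached by a downward jump from 1. *)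
Lemma ghatE j t : t != 0 -> ghat lam mu j t = mu * taboo j 1 t.
Proof.
move=> t0; rewrite /ghat /taboo /B.
have lm : lam / mu != 0 by rewrite gt_eqF// divr_gt0.
have ml : mu / lam != 0 by rewrite gt_eqF// divr_gt0.
have E1 : (mu / lam) `^ (j%:R / 2) * besselI j%:Z (2 * t * Num.sqrt (lam * mu)) =
    walk_egf lam mu (- j%:Z) t.
  rewrite walk_egf_opp// -walk_egf_bessel// mulrA; congr (_ * _).
  have -> : (lam / mu) `^ (j%:Z%:~R / 2) = (mu / lam) `^ (- (j%:R / 2)).
    have -> : lam / mu = (mu / lam) `^ (-1).
      by rewrite powR_inv1 ?invf_div// divr_ge0 ?ltW.
    by rewrite -powRrM mulN1r.
  rewrite -exprnP -powR_mulrn ?divr_ge0 ?ltW// -powRD; last exact/implyP.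
  by congr (_ `^ _); field.
have D := walk_egf_drift lam_gt0 mu_gt0 (- j%:Z) t.
have E2 : (mu / lam) ^+ j * walk_egf lam mu (1 + j%:Z) t * mu =
    lam * walk_egf lam mu (- j%:Z - 1) t.
  have -> : - j%:Z - 1 = - (1 + j%:Z) by lia.
  rewrite walk_egf_opp// expfzDr// expr1z -exprnP; field.
  by rewrite gt_eqF.
rewrite -mulrA E1.
have -> : mu * (expR (- (lam + mu) * t) * (walk_egf lam mu (1%:Z - j%:Z) t -
   (mu / lam) ^+ j * walk_egf lam mu (1%:Z + j%:Z) t)) =
  expR (- (lam + mu) * t) * (mu * walk_egf lam mu (- j%:Z + 1) t -
   (mu / lam) ^+ j * walk_egf lam mu (1 + j%:Z) t * mu).
  by rewrite [- j%:Z + 1]addrC; ring.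
rewrite E2.
have {}D : j%:R * walk_egf lam mu (- j%:Z) t =
   t * (mu * walk_egf lam mu (- j%:Z + 1) t - lam * walk_egf lam mu (- j%:Z - 1) t).
  have -> : j%:R = - (- j%:Z)%:~R :> R by rewrite rmorphN opprK.
  by rewrite mulNr D; ring.
have -> : j%:R / t * expR (- (lam + mu) * t) * walk_egf lam mu (- j%:Z) t =
  expR (- (lam + mu) * t) / t * (j%:R * walk_egf lam mu (- j%:Z) t) by ring.
by rewrite D; field.
Qed.

Lemma taboo_decay j T : exists2 C : R, 0 <= C &
  forall k t, 0 <= t <= T -> `|taboo j k t| <= C * 2^-1 ^+ k.
Proof.
have lm0 : 0 < lam + mu by rewrite addr_gt0.
exists (expR (2 * (lam + mu) * T) * (2 ^+ j + (mu / lam) ^+ j)).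
  by rewrite mulr_ge0 ?expR_ge0// addr_ge0// exprn_ge0// ltW// divr_gt0.
move=> k t /andP[t0 tT]; rewrite /taboo normrM ger0_norm ?expR_ge0//.
have e1 : expR (- (lam + mu) * t) <= 1.
  by rewrite -expR0 ler_expR mulNr oppr_le0 mulr_ge0// ltW.
apply: (@le_trans _ _ `|B (k%:Z - j%:Z) t - (mu / lam) ^+ j * B (k%:Z + j%:Z) t|).
  by rewrite ler_piMl.
have h v N : (N <= `|v|)%N ->
    `|B v t| <= 2^-1 ^+ N * expR (2 * (lam + mu) * T).
  move=> Nv; apply: le_trans (walk_egf_le lam_gt0 mu_gt0 v t) _.
  apply: ler_pM; rewrite ?expR_ge0 ?exprn_ge0 ?invr_ge0//.
    by rewrite ler_wiXn2l ?invr_ge0// invf_le1// ler1n.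
  by rewrite ler_expR ger0_norm// ler_pM2l// mulr_gt0.
apply: le_trans (ler_normB _ _) _.
have -> : expR (2 * (lam + mu) * T) * (2 ^+ j + (mu / lam) ^+ j) * 2^-1 ^+ k =
  2 ^+ j * 2^-1 ^+ k * expR (2 * (lam + mu) * T) +
  (mu / lam) ^+ j * (2^-1 ^+ k * expR (2 * (lam + mu) * T)) by ring.
apply: lerD.
  have kj : (k - j <= `|(k%:Z - j%:Z)|)%N by lia.
  apply: le_trans (h _ _ kj) _; rewrite ler_wpM2r ?expR_ge0//.
  have [jk|/ltnW kj'] := leqP j k.
    by rewrite -{2}(subnKC jk) exprD mulrA -exprMn divff// expr1n mul1r.
  have -> : (k - j = 0)%N by apply/eqP; rewrite subn_eq0.
  rewrite expr0 -(subnKC kj') exprD mulrAC -exprMn divff// expr1n mul1r.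
  by rewrite exprn_ege1// ler1n.
have r0 : 0 <= (mu / lam) ^+ j by rewrite exprn_ge0// ltW// divr_gt0.
rewrite normrM (ger0_norm r0); apply: ler_wpM2l => //.
by apply: h; lia.
Qed.

End Taboo.

(** * Duhamel formula *)

Section Duhamel.
Context {R : realType}.

(** Starting the integral at -1 makes the antiderivative differentiable on the
    whole closed interval. *)
Lemma antiderivative_itv (phi : R -> R) (t : R) : 0 < t -> continuous phi ->
  exists2 J : R -> R, (forall x, 0 <= x <= t -> is_derive x 1 J (phi x)) &
    (\int[lebesgue_measure]_(x in `]0%R, t[) (phi x)%:E = (J t - J 0)%:E)%E.
Proof.
move=> t0 cphi.
pose J (x : R) : R := (\int[lebesgue_measure]_(s in `[-1, x]) phi s)%R.
have iphi (b : R) : -1 <= b ->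
    lebesgue_measure.-integrable `[-1, b] (EFin \o phi).
  move=> b1; apply: continuous_compact_integrable; first exact: segment_compact.
  exact: continuous_subspaceT.
have JD (x : R) : -1 < x -> derivable J x 1 /\ derive1 J x = phi x.
  move=> x1; apply: (@continuous_FTC1_closed _ phi (-1) x (x + 1)) => //.
  - by rewrite ltrDl.
  - by apply: iphi; lra.
  - exact: cphi.
exists J.
  move=> x /andP[x0 xt]; have [|D1 D2] := JD x; first lra.
  by split => //; rewrite -derive1E.
have -> : (\int[lebesgue_measure]_(x in `]0%R, t[) (phi x)%:E =
    \int[lebesgue_measure]_(x in `[0%R, t]) (phi x)%:E)%E.
  symmetry; apply: integral_itv_bndoo; apply/measurable_realfun.measurable_EFinP.
  by apply: measurable_funTS; exact: measurable_realfun.continuous_measurable_fun.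
rewrite (@continuous_FTC2 _ phi J 0 t)//.
- exact: continuous_subspaceT.
- have JC (x : R) : -1 < x -> {for x, continuous J}.
    move=> /JD[/derivable1_diffP/differentiable_continuous]; exact.
  split.
  + by move=> x; rewrite in_itv/= => /andP[x0 _]; have [|] := JD x; first lra.
  + by apply: cvg_at_right_filter; apply: JC; lra.
  + by apply: cvg_at_left_filter; apply: JC; lra.
- by move=> x; rewrite in_itv/= => /andP[x0 _]; have [|] := JD x; first lra.
Qed.

(** Discrete Green identity: the operators of the forward equation, on [A], and
    of the backward equation, on [D], are mutually adjoint up to boundary terms.
    Those at level zero vanish. *)
Lemma sum_telescope_tridiag (lam mu eta : R) (A D s : nat -> R) K :
    A 0%N = 0 -> D 0%N = 0 ->
  \sum_(0 <= k < K)
    ((lam * A k + mu * A k.+2 - (lam + mu + eta) * A k.+1) * D k.+1 -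
     A k.+1 * (lam * D k.+2 + mu * D k - (lam + mu + eta) * D k.+1 +
       eta * s k.+1)) +
  eta * \sum_(0 <= k < K) A k.+1 * s k.+1 =
  mu * A K.+1 * D K - lam * A K * D K.+1.
Proof.
move=> A0 D0; rewrite mulr_sumr -big_split /=; elim: K => [|K IH].
  by rewrite big_nil A0 D0; ring.
by rewrite big_nat_recr//= IH; ring.
Qed.

Variables (lam mu eta : R).
Hypotheses (lam_gt0 : 0 < lam) (mu_gt0 : 0 < mu) (eta_ge0 : 0 <= eta).
Variables (w s : nat -> R -> R).
Hypothesis w0 : forall t, w 0 t = 0.
Hypothesis w_init : forall k, w k 0 = mu * (k == 1)%:R.
Hypothesis w_derive : forall (k : nat) (t : R), is_derive t 1 (w k.+1)
  (lam * w k.+2 t + mu * w k t - (lam + mu + eta) * w k.+1 t + eta * s k.+1 t).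
Hypothesis s_cont : forall k, continuous (s k).
Hypothesis w_bounded : forall T : R, exists C : R,
  forall (k : nat) (t : R), 0 <= t <= T -> `|w k t| <= C.

(** [w] solves the backward equation of the queue killed at zero and at rate
    [eta], with source [eta * s] and initial value [mu] at level 1.  For each
    truncation level [K], the pairing
    [\sum_(k < K) exp (- eta * tau) * taboo j k tau * w k (t - tau)]
    interpolates between [w j t] at [tau = 0] and the homogeneous solution at
    [tau = t].  After the source term has been compensated by its
    antiderivative, only the boundary term at level [K] remains in its
    derivative, and this tends to zero uniformly on [0, t]. *)
Lemma duhamel_taboo (j : nat) (t : R) : (0 < j)%N -> 0 < t ->
  exists I : nat -> R,
  (forall k, \int[lebesgue_measure]_(tau in `]0%R, t[)
     (expR (- eta * tau) * taboo lam mu j k.+1 tau * s k.+1 (t - tau))%:E =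
     (I k)%:E)%E /\
  eta * (\sum_(0 <= k < K) I k) @[K --> \oo] -->
    w j t - expR (- eta * t) * (mu * taboo lam mu j 1 t).
Proof.
move=> j0 t0.
pose A k (tau : R) := expR (- eta * tau) * taboo lam mu j k tau.
pose D k (tau : R) := w k (t - tau).
have AD k (tau : R) : is_derive tau 1 (A k.+1)
    (lam * A k tau + mu * A k.+2 tau - (lam + mu + eta) * A k.+1 tau).
  have := taboo_derive lam_gt0 mu_gt0 j k tau => ?.
  rewrite /A; apply: is_derive_eq; rewrite /GRing.scale/=; ring.
have DD k (tau : R) : is_derive tau 1 (D k.+1)
    (- (lam * D k.+2 tau + mu * D k tau - (lam + mu + eta) * D k.+1 tau +
        eta * s k.+1 (t - tau))).
  have wd := w_derive k (t - tau).
  have ld : is_derive tau 1 (fun tau : R => t - tau) (- 1).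
    by apply: is_derive_eq; rewrite add0r mul1r.
  have := @is_derive1_comp _ (w k.+1) (fun tau : R => t - tau) tau _ _ wd ld.
  move=> H; apply: (is_derive_eq H); rewrite /D /GRing.scale/=; ring.
have phi_cont k : continuous (fun tau => A k.+1 tau * s k.+1 (t - tau)).
  move=> x; apply: cvgM; first exact: is_derive_continuous (AD k x).
  apply: (@continuous_comp _ _ _ (fun tau : R => t - tau) (s k.+1)).
    by apply: cvgB; [exact: cvg_cst|exact: cvg_id].
  exact: s_cont.
have /choice[J HJ] : forall k, exists J : R -> R,
    (forall x, 0 <= x <= t -> is_derive x 1 J (A k.+1 x * s k.+1 (t - x))) /\
    (\int[lebesgue_measure]_(x in `]0%R, t[) (A k.+1 x * s k.+1 (t - x))%:E =
      (J t - J 0)%:E)%E.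
  by move=> k; have [J ? ?] := antiderivative_itv t0 (phi_cont k); exists J.
exists (fun k => J k t - J k 0); split; first by move=> k; case: (HJ k).
(* The truncated pairing, compensated for its source. *)
pose psi K tau := \sum_(0 <= k < K) A k.+1 tau * D k.+1 tau +
  eta * \sum_(0 <= k < K) J k tau.
have is_derive_sum_nat (F : nat -> R -> R) (F' : nat -> R) K (x : R) :
    (forall k, is_derive x 1 (F k) (F' k)) ->
    is_derive x 1 (fun y => \sum_(0 <= k < K) F k y) (\sum_(0 <= k < K) F' k).
  move=> FD; elim: K => [|K IH].
    rewrite big_nil (_ : (fun _ => _) = cst 0); last first.
      by apply/funext => y; rewrite big_nil.
    exact: is_derive_cst.
  rewrite big_nat_recr//= (_ : (fun _ => _) =
    (fun y => \sum_(0 <= k < K) F k y) + F K).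
    exact: is_deriveD.
  by apply/funext => y; rewrite big_nat_recr.
have psiD K (x : R) : 0 <= x <= t -> is_derive x 1 (psi K)
    (mu * A K.+1 x * D K x - lam * A K x * D K.+1 x).
  move=> xt.
  have d1 := is_derive_sum_nat (fun k tau => A k.+1 tau * D k.+1 tau) _ K x
    (fun k => is_deriveM (AD k x) (DD k x)).
  have d2 := is_derive_sum_nat J _ K x (fun k => (HJ k).1 x xt).
  have d3 := is_deriveD d1 (is_deriveZ eta d2).
  apply: (is_derive_eq d3).
  rewrite -(@sum_telescope_tridiag lam mu eta (A ^~ x) (D ^~ x) (fun k => s k (t - x))).
  - congr (_ + _); apply: eq_bigr => k _; rewrite /GRing.scale/=; ring.
  - by rewrite /A taboo_at0// mulr0.
  - exact: w0.
have [C1 C10 tabC] := taboo_decay lam_gt0 mu_gt0 j t.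
have [C2 wC] := w_bounded t.
have C20 : 0 <= C2.
  have := wC 0%N 0; rewrite lexx (ltW t0) => /(_ isT); exact: le_trans.
have AC k x : 0 <= x <= t -> `|A k x| <= C1 * 2^-1 ^+ k.
  move=> xt; apply: le_trans (tabC k x xt); rewrite /A normrM ger0_norm ?expR_ge0//.
  rewrite ler_piMl// -expR0 ler_expR mulNr oppr_le0 mulr_ge0//.
  by case/andP: xt.
have DC k x : 0 <= x <= t -> `|D k x| <= C2.
  by move=> /andP[x0 xt]; apply: wC; rewrite subr_ge0 xt gerBl.
have psi_le K : `|psi K t - psi K 0| <= (lam + mu) * C1 * C2 * t * 2^-1 ^+ K.
  have -> : (lam + mu) * C1 * C2 * t * 2^-1 ^+ K =
    (lam + mu) * (C1 * 2^-1 ^+ K) * C2 * (t - 0) by ring.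
  apply: (mean_value_le (ltW t0) (psiD K)) => x xt.
  apply: le_trans (ler_normB _ _) _.
  have h2 : 0 <= C1 * 2^-1 ^+ K by rewrite mulr_ge0// exprn_ge0// invr_ge0.
  have -> : (lam + mu) * (C1 * 2^-1 ^+ K) * C2 =
    mu * (C1 * 2^-1 ^+ K) * C2 + lam * (C1 * 2^-1 ^+ K) * C2 by ring.
  have aux (c a b : R) : 0 < c -> `|a| <= C1 * 2^-1 ^+ K -> `|b| <= C2 ->
      `|c * a * b| <= c * (C1 * 2^-1 ^+ K) * C2.
    move=> c0 aC bC; rewrite !normrM (gtr0_norm c0).
    by apply: ler_pM => //; rewrite ?mulr_ge0 ?(ltW c0)// ler_pM2l.
  apply: lerD; apply: aux => //; try exact: DC; last exact: AC.
  apply: le_trans (AC _ _ xt) _.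
  rewrite ler_wpM2l// exprS ler_piMl ?exprn_ge0 ?invr_ge0//.
  by rewrite invf_le1// ler1n.
have psi0 K : (j <= K)%N -> psi K 0 = w j t + eta * \sum_(0 <= k < K) J k 0.
  move=> jK; rewrite /psi; congr (_ + _).
  rewrite (bigD1_seq j.-1) ?mem_index_iota ?iota_uniq//=; last first.
    by rewrite prednK.
  rewrite prednK// big1 ?addr0.
    by rewrite /A /D mulr0 expR0 taboo_init// eqxx subr0 !mul1r.
  move=> k kj; rewrite /A taboo_init//.
  have -> : (k.+1 == j) = false by apply/negbTE; move: kj; apply: contra => /eqP <-.
  by rewrite mulr0 mul0r.
have psit K : (0 < K)%N -> psi K t =
    expR (- eta * t) * (mu * taboo lam mu j 1 t) + eta * \sum_(0 <= k < K) J k t.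
  move=> K0; rewrite /psi; congr (_ + _).
  rewrite -(subnKC K0) add1n big_nat_recl//= big1 ?addr0.
    by rewrite /A /D subrr w_init eqxx mulr1; ring.
  by move=> k _; rewrite /D subrr w_init mulr0 mulr0.
apply/cvgrPdist_le => e e0.
have lim : (lam + mu) * C1 * C2 * t * 2^-1 ^+ K @[K --> \oo] --> 0.
  rewrite -(mulr0 ((lam + mu) * C1 * C2 * t)); apply: cvgM; first exact: cvg_cst.
  by apply: cvg_expr; rewrite ger0_norm ?invr_ge0// invf_lt1// ltr1n.
have bnd : \forall K \near \oo, (lam + mu) * C1 * C2 * t * 2^-1 ^+ K <= e.
  exact: (cvgr_le _ lim).
near=> K.
have jK : (j <= K)%N by near: K; exact: nbhs_infty_ge.
have -> : w j t - expR (- eta * t) * (mu * taboo lam mu j 1 t) -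
    eta * (\sum_(0 <= k < K) (J k t - J k 0)) = - (psi K t - psi K 0).
  by rewrite psi0// psit ?(leq_trans j0)// sumrB; ring.
rewrite normrN; apply: le_trans (psi_le K) _.
by near: K.
Unshelve. all: by end_near. Qed.

End Duhamel.

(** * The two-environment queue *)

Section Queue.
Context {R : realType}.
Variables (lam mu eta : env -> R).
Hypothesis lam_gt0 : forall i, 0 < lam i.
Hypothesis mu_gt0 : forall i, 0 < mu i.
Hypothesis eta_ge0 : forall i, 0 <= eta i.
Implicit Types (i : env) (k n : nat) (x y : nat * env) (t : R).

Lemma envP i : i = env1 \/ i = env2.
Proof.
case: i => -[|[|m]] lt; last by [].
  by left; apply/val_inj.
by right; apply/val_inj.
Qed.

Definition other i : env := if i == env1 then env2 else env1.

Lemma other_neq i : other i != i.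
Proof. by case: (envP i) => ->. Qed.

Lemma neq_other i i' : i' != i -> i' = other i.
Proof. by case: (envP i) => ->; case: (envP i') => ->. Qed.

Definition neighbours x : seq (nat * env) :=
  [:: (x.1.+1, x.2), (x.1, other x.2) &
      if x.1 is n.+1 then [:: (n, x.2)] else [::]].

Let rate := queue_rate lam mu eta.

Lemma neighbours_uniq x : uniq (x :: neighbours x).
Proof.
have oi i : (i == other i) = false by rewrite eq_sym (negbTE (other_neq i)).
have io i : (other i == i) = false by rewrite (negbTE (other_neq i)).
have ii i : (i == i) = true by rewrite eqxx.
by case: x => [[|n] i] /=; rewrite !inE !xpair_eqE /= ?oi ?io ?ii; lia.
Qed.

Lemma queue_rate_ge0 x y : 0 <= rate x y.
Proof.
rewrite /rate /queue_rate; do ![case: ifP => // _]; first exact: ltW.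
exact: ltW.
Qed.

Lemma queue_rate_out x y : x != y -> y \notin neighbours x -> rate x y = 0.
Proof.
case: x y => [k i] [k' i'] /= ne; rewrite /neighbours /rate /queue_rate /= !inE.
rewrite !xpair_eqE => /norP[/= n1 /norP[n2 n3]].
have [ii|/eqP/nesym/eqP ii] := eqVneq i i'.
  subst i'; rewrite eqxx andbT in n1; rewrite (negbTE n1).
  case: eqP => // kk; move: n3.
  by rewrite kk /= mem_seq1 eqxx.
case: eqP => // kk; move: n2.
by rewrite kk eqxx -(neq_other ii) eqxx.
Qed.

Lemma big_neighbours (F : nat * env -> R) k i :
  \sum_(y <- neighbours (k, i)) rate (k, i) y * F y =
  lam i * F (k.+1, i) + eta i * F (k, other i) +
  (if k is n.+1 then mu i * F (n, i) else 0).
Proof.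
rewrite /neighbours !big_cons /= /rate /queue_rate /= !eqxx.
rewrite eq_sym (negbTE (other_neq i)) addrA; congr (_ + _).
case: k => [|n]; first by rewrite big_nil.
by rewrite big_seq1 /= (_ : (n == n.+2) = false) ?eqxx//; lia.
Qed.

Definition total_rate : R :=
  (lam env1 + lam env2) + (mu env1 + mu env2) + (eta env1 + eta env2).

Lemma queue_rate_le x : \sum_(y <- neighbours x) rate x y <= total_rate.
Proof.
case: x => k i; have := big_neighbours (fun=> 1) k i.
under eq_bigr do rewrite mulr1.
move=> ->; rewrite /total_rate !mulr1.
have l1 := lam_gt0 env1; have l2 := lam_gt0 env2.
have m1 := mu_gt0 env1; have m2 := mu_gt0 env2.
have e1 := eta_ge0 env1; have e2 := eta_ge0 env2.
by case: (envP i) => ->; case: k => [|n]; rewrite ?mulr1; lra.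
Qed.

Definition busy : pred (nat * env) := fun x => x.1 != 0%N.

Let kill := killed rate neighbours busy.

Lemma killed_queueE g k i : kill g (k.+1, i) =
  lam i * g (k.+2, i) + mu i * g (k, i) + eta i * g (k.+1, other i) -
  (lam i + mu i + eta i) * g (k.+1, i).
Proof.
rewrite /kill /killed mul1r generatorE big_neighbours.
have := big_neighbours (fun=> 1) k.+1 i; under eq_bigr do rewrite mulr1.
move=> ->; ring.
Qed.

Let init x : R := (busy x)%:R.

Let init_le x : `|init x| <= 1.
Proof. by rewrite /init; case: (busy x); rewrite ?normr1 ?normr0. Qed.

Definition busy_prob t x := killed_semigroup rate neighbours busy init t x.
(** Minus the time derivative of [busy_prob], in the form
    [exp (t * killed) (- killed 1_busy)], which shows its own evolution
    equation and its initial value, the rate of jumping to the empty queue. *)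
Definition exit_density t x :=
  - killed_semigroup rate neighbours busy (kill init) t x.

Lemma busy_prob_derive t x :
  is_derive t 1 (busy_prob ^~ x) (- exit_density t x).
Proof.
rewrite /exit_density opprK -(killed_semigroup_comm queue_rate_ge0 queue_rate_le busy t x init_le).
exact: (killed_semigroup_derive queue_rate_ge0 queue_rate_le busy t x init_le).
Qed.

Let kill_init_le := killed_le queue_rate_ge0 queue_rate_le busy init_le.

Lemma exit_density_derive t x :
  is_derive t 1 (exit_density ^~ x) (kill (exit_density t) x).
Proof.
have := killed_semigroup_derive queue_rate_ge0 queue_rate_le busy t x kill_init_le => D.
have -> : kill (exit_density t) x =
   - kill (killed_semigroup rate neighbours busy (kill init) t) x.
  rewrite /kill /killed -[RHS]mulrN /generator -sumrN; congr (_ * _).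
  by apply: eq_bigr => y _; rewrite /exit_density; ring.
exact: is_deriveN.
Qed.

Lemma exit_density_le t x :
  `|exit_density t x| <= 1 * (2 * total_rate) * expR (2 * total_rate * `|t|).
Proof.
rewrite normrN.
exact: (killed_semigroup_le queue_rate_ge0 queue_rate_le busy t x kill_init_le).
Qed.

Lemma exit_density_idle t i : exit_density t (0%N, i) = 0.
Proof.
rewrite /exit_density killed_semigroup_out ?oppr0// => x nx.
by rewrite /kill /killed (negbTE nx) mul0r.
Qed.

Lemma exit_density0 k i : exit_density 0 (k, i) = mu i * (k == 1)%:R.
Proof.
case: k => [|k]; first by rewrite exit_density_idle mulr0.
rewrite /exit_density killed_semigroup0 killed_queueE /init /busy /= eqSS.
by case: k => [|k] /=; ring.
Qed.

(** In the fixed environment [i], switching to the other environment acts as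
    killing at rate [eta i] together with a source. *)
Lemma exit_density_duhamel i j t : (0 < j)%N -> 0 < t ->
  exists I : nat -> R,
  (forall k, \int[lebesgue_measure]_(tau in `]0%R, t[)
     (expR (- eta i * tau) * taboo (lam i) (mu i) j k.+1 tau *
      exit_density (t - tau) (k.+1, other i))%:E = (I k)%:E)%E /\
  eta i * (\sum_(0 <= k < K) I k) @[K --> \oo] -->
    exit_density t (j, i) - expR (- eta i * t) * ghat (lam i) (mu i) j t.
Proof.
move=> j0 t0; rewrite ghatE ?gt_eqF//.
apply: (duhamel_taboo (lam_gt0 i) (mu_gt0 i) (eta_ge0 i)
  (w := fun k t => exit_density t (k, i))
  (s := fun k t => exit_density t (k, other i))) => //.
- by move=> s; exact: exit_density_idle.
- by move=> k; exact: exit_density0.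
- move=> k s; apply: is_derive_eq (exit_density_derive s (k.+1, i)) _.
  by rewrite killed_queueE; ring.
- move=> k s.
  exact: is_derive_continuous (exit_density_derive s (k, other i)).
- move=> T; exists (1 * (2 * total_rate) * expR (2 * total_rate * T)).
  move=> k s /andP[s0 sT]; apply: le_trans (exit_density_le _ _) _.
  have q0 := killed_growth_ge0 queue_rate_ge0 queue_rate_le (0%N, env1).
  by rewrite mul1r ler_wpM2l// ler_expR ler_wpM2l// ger0_norm.
Qed.

(** Without switching the source disappears, and the formula is the one of a
    single M/M/1 queue. *)
Lemma exit_density_autonomous i j t : eta i = 0 -> (0 < j)%N -> 0 < t ->
  exit_density t (j, i) = ghat (lam i) (mu i) j t.
Proof.
move=> eta0 j0 t0; have [I [_]] := exit_density_duhamel i j0 t0.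
rewrite eta0 oppr0 mul0r expR0 mul1r => lim.
have l0 : 0 * (\sum_(0 <= k < K) I k) @[K --> \oo] --> 0.
  rewrite (_ : (fun _ => _) = cst 0); first exact: cvg_cst.
  by apply/funext => K; rewrite mul0r.
by apply/eqP; rewrite -subr_eq0; apply/eqP; exact: (cvg_unique _ lim l0).
Qed.

End Queue.

(** * The first-passage time *)

Section FirstPassage.
Context {R : realType} {d : measure_display} {Omega : measurableType d}.
Variables (P : probability Omega R) (lam mu eta : env -> R).
Variables (N : R -> Omega -> nat * env).
Hypothesis lam_gt0 : forall i, 0 < lam i.
Hypothesis mu_gt0 : forall i, 0 < mu i.
Hypothesis eta_ge0 : forall i, 0 <= eta i.
Hypothesis NP : ctmc (queue_rate lam mu eta) P N.

Let hit t : set Omega := [set w | (first_passage_time N w < t%:E)%E].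

Lemma hitE t w : hit t w <-> exists s : R, 0 < s < t /\ ~~ busy (N s w).
Proof.
split.
  move=> /ereal_inf_ltP[_ [s [s0 Ns] <-]]; rewrite lte_fin => st.
  by exists s; rewrite s0 st; split => //; rewrite /busy; case: Ns => ->.
move=> [s [/andP[s0 st] Ns]]; apply/ereal_inf_ltP; exists s%:E; last first.
  by rewrite lte_fin.
exists s => //; split => //; move: Ns; rewrite /busy negbK.
case: (N s w) => k i /= /eqP ->.
by case: (envP i) => ->; [left|right].
Qed.

(** By right-continuity an empty queue at time [s] is still empty at some
    rational time between [s] and [t]. *)
Lemma measurable_hit t : measurable (hit t).
Proof.
have [tp tpP XP] := NP.
have -> : hit t = \bigcup_(r in [set r : rat | (0 : R) < ratr r < t])
    \bigcup_(x in [set x | ~~ busy x]) [set w | N (ratr r) w = x].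
  apply/seteqP; split => w.
    move=> /hitE[s [/andP[s0 st] nb]].
    have [e /= e0 He] := ctmc_right_continuous XP w (ltW s0).
    have [|r] := @rat_in_itvoo R s (Num.min t (s + e)).
      by rewrite lt_min st ltrDl.
    rewrite in_itv/= lt_min => /andP[sr /andP[rt rse]].
    exists r; first by rewrite /= rt (lt_trans s0).
    exists (N (ratr r) w) => //=; rewrite He//=.
    by rewrite ltr0_norm ?subr_lt0// opprB ltrBlDl.
  move=> [r /= rt [x /= nb Nx]]; apply/hitE; exists (ratr r).
  by rewrite Nx.
rewrite bigcup_mkcond; apply: countable_bigcupT_measurable => // r.
case: ifP => // /set_mem /= /andP[r0 _].
rewrite bigcup_mkcond; apply: countable_bigcupT_measurable => // x.
by case: ifP => // _; apply: (ctmc_measurable XP); exact: ltW.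
Qed.

Lemma survive_prob t x : 0 < t -> busy x ->
  P ([set w | N 0 w = x] `&` ~` hit t) =
  (P [set w | N 0 w = x] * (busy_prob lam mu eta t x)%:E)%E.
Proof.
move=> t0 bx; have [tp tpP XP] := NP.
have -> : [set w | N 0 w = x] `&` ~` hit t =
    [set w | N 0 w = x] `&` stays_before N busy t.
  apply/seteqP; split => w /= [N0 H]; split => //.
    move=> s /andP[]; rewrite le_eqVlt => /predU1P[<- _|s0 st].
      by rewrite N0.
    by case: (boolP (busy _)) => // nb; case: H; apply/hitE; exists s; rewrite s0 st.
  by move=> /hitE[s [/andP[s0 st]]] /negP; apply; apply: H; rewrite ltW.
have i1 x' : `|(busy x')%:R : R| <= 1.
  by case: (busy x'); rewrite ?normr1 ?normr0.
apply: (stays_before_prob tpP XP (@neighbours_uniq) (queue_rate_ge0 lam_gt0 mu_gt0 eta_ge0)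
  (@queue_rate_out _ lam mu eta) (queue_rate_le lam_gt0 mu_gt0 eta_ge0) t0
  (K := 1 * (2 * total_rate lam mu eta) ^+ 2 * expR (2 * total_rate lam mu eta * t))).
- by rewrite mulr_ge0 ?expR_ge0// mul1r exprn_even_ge0.
- by move=> y; rewrite /busy_prob killed_semigroup0.
- by move=> s y nb; rewrite /busy_prob killed_semigroup_out// => z /negbTE ->.
- move=> y; apply: is_derive_continuous.
  exact: (busy_prob_derive lam_gt0 mu_gt0 eta_ge0 t y).
- move=> s e y by_ s0 e0 se.
  exact: (killed_semigroup_taylor (queue_rate_ge0 lam_gt0 mu_gt0 eta_ge0)
    (queue_rate_le lam_gt0 mu_gt0 eta_ge0) i1).
Qed.

Variables (p : R) (j : nat).
Hypothesis j_gt0 : (0 < j)%N.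
Hypothesis N_init1 : P [set w | N 0 w = (j, env1)] = p%:E.
Hypothesis N_init2 : P [set w | N 0 w = (j, env2)] = (1 - p)%:E.

(** The two initial states carry the whole mass, so that the rest of the event
    is negligible. *)
Lemma first_passage_cdfE t : 0 < t ->
  first_passage_cdf P N t = 1 - (p * busy_prob lam mu eta t (j, env1) +
                                 (1 - p) * busy_prob lam mu eta t (j, env2)).
Proof.
move=> t0; have [tp tpP XP] := NP.
have bj i : busy (j, i) by rewrite /busy /= -lt0n.
pose A i := [set w | N 0 w = (j, i)].
have mA i : measurable (A i) by apply: (ctmc_measurable XP).
have mC : measurable (~` hit t) by apply: measurableC; exact: measurable_hit.
have dA : A env1 `&` A env2 = set0.
  by apply/seteqP; split => // w [A1 A2]; move: A1; rewrite /A /= A2 => -[].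
rewrite /first_passage_cdf -/(hit t).
have P0 : P (~` (A env1 `|` A env2)) = 0%E.
  have -> : P (~` (A env1 `|` A env2)) = (1 - P (A env1 `|` A env2))%E.
    by apply: probability_setC; exact: measurableU.
  have -> : P (A env1 `|` A env2) = (P (A env1) + P (A env2))%E.
    exact: measureU.
  by rewrite N_init1 N_init2 -EFinD [p + _]addrC subrK subrr.
have PC : P (~` hit t) = (p * busy_prob lam mu eta t (j, env1) +
                   (1 - p) * busy_prob lam mu eta t (j, env2))%:E.
  rewrite (measureDI P mC (mA env1)).
  rewrite (measureDI P (measurableD mC (mA env1)) (mA env2)).
  rewrite [X in (X + _ + _)%E](_ : _ = 0%E); last first.
    apply: (subset_measure0 _ _ _ P0).
    - by apply: measurableD => //; exact: measurableD.
    - by apply: measurableC; exact: measurableU.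
    - by move=> w [[_ n1] n2] [].
  rewrite add0e (_ : (~` hit t `\` A env1) `&` A env2 = A env2 `&` ~` hit t); last first.
    apply/seteqP; split => w; first by move=> [[]].
    move=> [A2 H]; split => //; split => // A1.
    by suff : set0 w by []; rewrite -dA.
  have Pi i : P (A i `&` ~` hit t) =
      (P (A i) * (busy_prob lam mu eta t (j, i))%:E)%E.
    exact: survive_prob.
  rewrite [~` hit t `&` _]setIC [X in (X + _)%E]Pi [X in (_ + X)%E]Pi.
  by rewrite N_init1 N_init2 -!EFinM -EFinD addrC.
have -> : P (hit t) = (1 - P (~` hit t))%E.
  by rewrite -{1}(setCK (hit t)); exact: probability_setC.
by rewrite PC -EFinB.
Qed.

Lemma first_passage_density_derive (t : R) : 0 < t ->
  is_derive t 1 (first_passage_cdf P N)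
    (p * exit_density lam mu eta t (j, env1) +
     (1 - p) * exit_density lam mu eta t (j, env2)).
Proof.
move=> t0.
pose F (s : R) := 1 - (p * busy_prob lam mu eta s (j, env1) +
                 (1 - p) * busy_prob lam mu eta s (j, env2)).
have FD : is_derive t 1 F (p * exit_density lam mu eta t (j, env1) +
     (1 - p) * exit_density lam mu eta t (j, env2)).
  have := busy_prob_derive lam_gt0 mu_gt0 eta_ge0 t (j, env1) => ?.
  have := busy_prob_derive lam_gt0 mu_gt0 eta_ge0 t (j, env2) => ?.
  rewrite /F; apply: is_derive_eq; rewrite /GRing.scale/=; ring.
have near_eq : \near t, F t = first_passage_cdf P N t.
  by near=> s; rewrite first_passage_cdfE//; near: s; exact: lt_nbhsr.
have [Fd Fv] := FD; split; first exact: near_eq_derivable Fd.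
by rewrite -(near_eq_derive _ near_eq).
Unshelve. all: by end_near. Qed.

End FirstPassage.

Theorem proposition4 (R : realType) (lam mu eta : env -> R) (p : R) (j : nat)
    (d : measure_display) (Omega : measurableType d) (P : probability Omega R)
    (N : R -> Omega -> nat * env)
    (lam_gt0 : forall i : env, 0 < lam i) (mu_gt0 : forall i : env, 0 < mu i)
    (eta1_gt0 : 0 < eta env1) (eta2_eq0 : eta env2 = 0)
    (p_ge0 : 0 <= p) (p_le1 : p <= 1) (j_gt0 : (0 < j)%N)
    (N_ctmc : ctmc (queue_rate lam mu eta) P N)
    (N_init1 : P [set w | N 0 w = (j, env1)] = p%:E)
    (N_init2 : P [set w | N 0 w = (j, env2)] = (1 - p)%:E)
    (t : R) (t_gt0 : 0 < t) :
  derivable (first_passage_cdf P N) t 1 /\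
  ((first_passage_density P N t)%:E =
     (p * expR (- eta env1 * t) * ghat (lam env1) (mu env1) j t)%:E +
     ((1 - p) * ghat (lam env2) (mu env2) j t)%:E +
     (eta env1 * p)%:E *
       \sum_(1 <= k <oo)
         \int[lebesgue_measure]_(tau in `]0%R, t[)
           (expR (- eta env1 * tau) * alphahat (lam env1) (mu env1) j k tau *
            ghat (lam env2) (mu env2) k (t - tau))%:E)%E.
Proof.
have eta_ge0 i : 0 <= eta i.
  by case: (envP i) => ->; [exact: ltW|rewrite eta2_eq0].
have [der val] := first_passage_density_derive lam_gt0 mu_gt0 eta_ge0 N_ctmc
  j_gt0 N_init1 N_init2 t_gt0.
split; first exact: der.
rewrite /first_passage_density derive1E val.
have env2E k s : (0 < k)%N -> 0 < s ->
    exit_density lam mu eta s (k, env2) = ghat (lam env2) (mu env2) k s.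
  exact: exit_density_autonomous.
have [I [IE Ilim]] := exit_density_duhamel lam_gt0 mu_gt0 eta_ge0 env1 j_gt0 t_gt0.
pose S := (exit_density lam mu eta t (j, env1) -
  expR (- eta env1 * t) * ghat (lam env1) (mu env1) j t) / eta env1.
have IS : \sum_(0 <= k < K) I k @[K --> \oo] --> S.
  have -> : (fun K => \sum_(0 <= k < K) I k) =
      fun K => (eta env1)^-1 * (eta env1 * \sum_(0 <= k < K) I k).
    by apply/funext => K; rewrite mulKf// gt_eqF.
  by rewrite /S mulrC; apply: cvgM => //; exact: cvg_cst.
have -> : (\sum_(1 <= k <oo) \int[lebesgue_measure]_(tau in `]0%R, t[)
    (expR (- eta env1 * tau) * alphahat (lam env1) (mu env1) j k tau *
     ghat (lam env2) (mu env2) k (t - tau))%:E = S%:E)%E.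
  apply: cvg_lim => //; rewrite -cvg_shiftS /=.
  rewrite [X in X @ _](_ : _ = fun K => (\sum_(0 <= k < K) I k)%:E).
    by apply: cvg_EFin; [near=> K|exact: IS].
  apply/funext => K; rewrite big_add1 /= -sumEFin; apply: eq_bigr => k _.
  rewrite -IE; apply: eq_integral => tau.
  rewrite inE/= in_itv/= => /andP[tau0 taut].
  by rewrite alphahatE// env2E// subr_gt0.
rewrite -EFinM -!EFinD env2E//; congr EFin.
rewrite /S; field; by rewrite gt_eqF.
Unshelve. all: by end_near. Qed.
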